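(* Let $\omega_0=dx\wedge dy$ be the standard symplectic form on $\mathbb{R}^2$, and let $L,K$ be two germs of smooth curves at points $p_1,p_2\in\mathbb{R}^2$ respectively, with $p_1\ne p_2$. Assume that: (a) the affine tangent lines $T_{p_1}L$ and $T_{p_2}K$ intersect transversely at a point $p_0\in\mathbb{R}^2$; (b) the affine line containing $p_1,p_2$ intersects both $L$ and $K$ transversely; (c) the curvatures of $L,K$ at $p_1,p_2$ respectively are non-zero; so that $(\mathbb{R}^2,\omega_0,\mathcal{F}_L,\mathcal{F}_K)$ is a bi-Lagrangian structure-germ at $p_0$ with foliations $\mathcal{F}_L=\{T_qL: q\in L\}$, $\mathcal{F}_K=\{T_qK: q\in K\}$. Then the canonical connection $\nabla$ of the bi-Lagrangian structure-germ $(\mathbb{R}^2,\omega_0,\mathcal{F}_L,\mathcal{F}_K)$ is never flat.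
   Context: A bi-Lagrangian structure $(M,\omega,\mathcal{F},\mathcal{G})$ consists of a symplectic manifold $(M,\omega)$ and two foliations $\mathcal{F},\mathcal{G}$ of $M$ whose leaves are Lagrangian submanifolds and intersect transversely at each point. (If $\dim M=2$ this means a surface with an area form and two transverse foliations by curves.) Its canonical connection is the unique affine connection $\nabla$ such that: $\nabla\omega=0$; $\nabla_v\Gamma(T\mathcal{F})\subseteq T\mathcal{F}$ and $\nabla_v\Gamma(T\mathcal{G})\subseteq T\mathcal{G}$ for each $v\in TM$; and $\nabla_XY-\nabla_YX=[X,Y]$ for $X\in\Gamma(T\mathcal{F})$, $Y\in\Gamma(T\mathcal{G})$. A structure-germ at $p_0$ is a structure on some open neighbourhood of $p_0$, considered up to shrinking the neighbourhood; its canonical connection is flat if its curvature tensor vanishes identically on some neighbourhood of $p_0$. Here $T_qL$ denotes the affine line tangent to $L$ at $q$, and the leaves of $\mathcal{F}_L$ (resp. $\mathcal{F}_K$) near $p_0$ are pieces of the affine tangent lines $T_qL$, $q\in L$ close to $p_1$ (resp. $T_qK$, $q\in K$ close to $p_2$). *)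

(* Defs.v *)
(* The plane R^2 is R * R, for R : realType. *)
From mathcomp Require Import all_boot all_order all_algebra.
From mathcomp Require Import all_classical all_reals all_analysis.

Set Implicit Arguments.
Unset Strict Implicit.
Unset Printing Implicit Defensive.
Import Order.TTheory GRing.Theory Num.Theory.
Import numFieldNormedType.Exports.

Local Open Scope ring_scope.
Local Open Scope classical_set_scope.

Section Smooth.
Context {R : realType} {E E' : normedModType R}.

(* C^k on an open set [V]. Only used for finite-dimensional [E], where this
   agrees with continuity of all partial derivatives of order at most k. *)
Fixpoint is_Ck (k : nat) (V : set E) (f : E -> E') : Prop :=
  match k with
  | 0 => forall x, V x -> {for x, continuous f}
  | k'.+1 => (forall x, V x -> differentiable f x) /\
             forall v : E, is_Ck k' V (fun x => 'D_v f x)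
  end.

Definition smooth_on (V : set E) (f : E -> E') : Prop :=
  forall k, is_Ck k V f.

End Smooth.

Section Plane.
Context {R : realType}.
Implicit Types (p q v w : R * R) (U V : set (R * R)).
Implicit Types (X Y Z : R * R -> R * R) (L : R -> R * R).

Definition line_span v : set (R * R) := range (fun c : R => c *: v).

Definition transverse (A B : set (R * R)) : Prop :=
  forall z, exists v w, [/\ A v, B w & z = v + w].

Definition curve_germ L (a : R) p : Prop :=
  [/\ exists I : set R, [/\ open I, I a & smooth_on I L],
      L^`() a <> 0 & L a = p].

Definition tangent_space L (a : R) : set (R * R) := line_span (L^`() a).

Definition tangent_line L (a : R) : set (R * R) :=
  [set p | tangent_space L a (p - L a)].

Definition enorm v : R := Num.sqrt (v.1 ^+ 2 + v.2 ^+ 2).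

(* Signed curvature, det(L', L'') / |L'|^3. *)
Definition curvature L (a : R) : R :=
  ((L^`() a).1 * (L^`(2) a).2 - (L^`() a).2 * (L^`(2) a).1)
    / enorm (L^`() a) ^+ 3.

Definition path_connected (l : set (R * R)) : Prop :=
  forall p q, l p -> l q ->
  exists g : R -> R * R, [/\ {within `[0, 1], continuous g},
    g 0 = p, g 1 = q & forall t, 0 <= t <= 1 -> l (g t)].

Definition local_coordinates V (phi : R * R -> R * R) : Prop :=
  [/\ open V, smooth_on V phi &
      exists psi : R * R -> R * R,
        [/\ open (phi @` V), smooth_on (phi @` V) psi &
            forall p, V p -> psi (phi p) = p]].

(* A partition of [U] into path-connected leaves such that, in suitable local
   coordinates, the components of the trace of each leaf are the level sets of
   the second coordinate. *)
Definition foliation U (F : set (set (R * R))) : Prop :=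
  [/\ open U,
      forall l, F l -> [/\ l !=set0, l `<=` U & path_connected l],
      forall p, U p -> exists2 l, F l & l p,
      forall l l', F l -> F l' -> l `&` l' !=set0 -> l = l' &
      forall p, U p -> exists V phi,
        [/\ V p, V `<=` U, local_coordinates V phi &
            forall l q, F l -> (V `&` l) q ->
              connected_component (V `&` l) q =
              [set q' | V q' /\ (phi q').2 = (phi q).2]]].

(* The tangent space at [p] of the leaf through [p]: the velocities of the
   smooth curves contained in that leaf. *)
Definition tangent (F : set (set (R * R))) p : set (R * R) :=
  [set v | exists (l : set (R * R)) (I : set R) (g : R -> R * R),
     [/\ F l, open I, I 0, smooth_on I g &
         [/\ forall t, I t -> l (g t), g 0 = p & g^`() 0 = v]]].

(* Closedness is automatic for a 2-form in dimension 2. *)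
Definition symplectic U (omega : R * R -> R * R -> R * R -> R) : Prop :=
  [/\ forall v w, smooth_on U (fun p => omega p v w),
      forall p v v' w (c : R), U p ->
        omega p (c *: v + v') w = c * omega p v w + omega p v' w,
      forall p v w, U p -> omega p v w = - omega p w v &
      forall p v, U p -> (forall w, omega p v w = 0) -> v = 0].

Definition omega0 p v w : R := v.1 * w.2 - v.2 * w.1.

(* Leaves of a [foliation] already have half the dimension of the plane. *)
Definition lagrangian U (omega : R * R -> R * R -> R * R -> R)
    (F : set (set (R * R))) : Prop :=
  forall p v w, U p -> tangent F p v -> tangent F p w -> omega p v w = 0.

Definition bilagrangian U (omega : R * R -> R * R -> R * R -> R)
    (F G : set (set (R * R))) : Prop :=
  [/\ symplectic U omega,
      foliation U F /\ foliation U G,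
      lagrangian U omega F /\ lagrangian U omega G &
      forall p, U p -> transverse (tangent F p) (tangent G p)].

Definition section V (F : set (set (R * R))) Y : Prop :=
  smooth_on V Y /\ forall p, V p -> tangent F p (Y p).

Definition lie_bracket X Y : R * R -> R * R :=
  fun p => 'D_(X p) Y p - 'D_(Y p) X p.

(* A connection on [U] acts on the vector fields over every open subset of [U],
   compatibly with restriction. Fields and functions over [V] are represented
   by total functions whose values outside [V] are irrelevant. *)
Definition affine_connection U
    (nabla : (R * R -> R * R) -> (R * R -> R * R) -> R * R -> R * R) : Prop :=
  forall V, open V -> V `<=` U ->
  [/\ forall X Y, smooth_on V X -> smooth_on V Y -> smooth_on V (nabla X Y),
      forall X X' Y Y', smooth_on V X -> smooth_on V Y ->
        (forall p, V p -> X p = X' p) -> (forall p, V p -> Y p = Y' p) ->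
        forall p, V p -> nabla X Y p = nabla X' Y' p,
      forall (f : R * R -> R) X X' Y, smooth_on V f -> smooth_on V X ->
        smooth_on V X' -> smooth_on V Y -> forall p, V p ->
        nabla (fun q => f q *: X q + X' q) Y p =
        f p *: nabla X Y p + nabla X' Y p,
      forall X Y Y', smooth_on V X -> smooth_on V Y -> smooth_on V Y' ->
        forall p, V p ->
        nabla X (fun q => Y q + Y' q) p = nabla X Y p + nabla X Y' p &
      forall (f : R * R -> R) X Y, smooth_on V f -> smooth_on V X ->
        smooth_on V Y -> forall p, V p ->
        nabla X (fun q => f q *: Y q) p =
        'D_(X p) f p *: Y p + f p *: nabla X Y p].

Definition canonical_connection U (omega : R * R -> R * R -> R * R -> R)
    (F G : set (set (R * R)))
    (nabla : (R * R -> R * R) -> (R * R -> R * R) -> R * R -> R * R) : Prop :=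
  affine_connection U nabla /\
  forall V, open V -> V `<=` U ->
  [/\ forall X Y Z, smooth_on V X -> smooth_on V Y -> smooth_on V Z ->
        forall p, V p ->
        'D_(X p) (fun q => omega q (Y q) (Z q)) p =
        omega p (nabla X Y p) (Z p) + omega p (Y p) (nabla X Z p),
      forall X Y, smooth_on V X -> section V F Y -> section V F (nabla X Y),
      forall X Y, smooth_on V X -> section V G Y -> section V G (nabla X Y) &
      forall X Y, section V F X -> section V G Y -> forall p, V p ->
        nabla X Y p - nabla Y X p = lie_bracket X Y p].

Definition curvature_tensor
    (nabla : (R * R -> R * R) -> (R * R -> R * R) -> R * R -> R * R)
    X Y Z : R * R -> R * R :=
  fun p => nabla X (nabla Y Z) p - nabla Y (nabla X Z) p
           - nabla (lie_bracket X Y) Z p.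

Definition flat_at p0 U
    (nabla : (R * R -> R * R) -> (R * R -> R * R) -> R * R -> R * R) : Prop :=
  exists V, [/\ open V, V p0, V `<=` U &
    forall X Y Z, smooth_on V X -> smooth_on V Y -> smooth_on V Z ->
    forall p, V p -> curvature_tensor nabla X Y Z p = 0].

(* The germ of [F] at [p0] is the family of tangent lines of the curve germ of
   [L] at [L a]: near [p0], leaves are pieces of the lines tangent to [L] at
   points of parameter close to [a]. *)
Definition tangent_foliation_germ L (a : R) p0 U (F : set (set (R * R))) :
    Prop :=
  forall e : R, 0 < e -> exists V, [/\ open V, V p0, V `<=` U &
    forall p l, V p -> F l -> l p ->
    exists2 s, `|s - a| < e &
      connected_component (V `&` l) p `<=` tangent_line L s].

(* [U], [F], [G] represent the structure-germ (R^2, omega0, F_L, F_K) at [p0]. *)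
Definition bilagrangian_tangent_germ L (a : R) (K : R -> R * R) (b : R) p0
    U (F G : set (set (R * R))) : Prop :=
  [/\ U p0, bilagrangian U omega0 F G,
      tangent_foliation_germ L a p0 U F & tangent_foliation_germ K b p0 U G].

End Plane.

(* Main.v *)
From HB Require Import structures.
Require Import Defs.
From mathcomp Require Import all_boot all_order all_algebra.
From mathcomp Require Import all_classical all_reals all_analysis.
From mathcomp Require Import ring lra.
Import Order.TTheory GRing.Theory Num.Theory.
Import numFieldNormedType.Exports.
Local Open Scope ring_scope.
Local Open Scope classical_set_scope.
Set Implicit Arguments.
Unset Strict Implicit.
Unset Printing Implicit Defensive.

(** Write [[u, v]] for the determinant of two vectors of the plane.

Near [p0] every point [p] lies on exactly one of the tangent lines of [L] close
to the one at [a], touching [L] at a parameter [S p], and likewise on exactly one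
of the tangent lines of [K], touching it at [T p]. Indeed [S] solves the equation
[[p - L s, L' s] = 0], whose derivative in [s] is [[p - L s, L'' s]]; at [p0] this
is nonzero because [p0] is not the contact point [p1] (else the line through [p1]
and [p2] would be tangent to [K]) and [L] is curved. A scalar implicit function
theorem gives [S] and [T] with explicit gradients ([implicit_function],
[exists_tangent_param]).

The vectors [al p = p - L (S p)] and [be p = p - K (T p)] are tangent to the two
foliations and form a frame. When [p] moves along [al] the contact point on [L]
does not move, so the frame has very simple derivatives: for functions [lam], [rho]
and the coordinates [x], [y] of [z] in the frame, the derivative of [al] along [z]
is [z - lam y al] and that of [be] is [z - rho x be] ([radial_frame_net]). The
axioms of the canonical connection then determine it on the frame, and the result
is remarkably simple: it is [D + Gamma], where [D] is the flat derivative of the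
plane and [Gamma] is the symmetric tensor with [Gamma(al, al) = al],
[Gamma(be, be) = be] and [Gamma(al, be) = - al - be] ([canonical_unique]).
Conversely [D + Gamma] satisfies the axioms ([canonical_radial_connection]). Since
the curvilinear square cut out by [S] and [T] around [p0] is a foliation chart for
both families of lines, this proves existence ([net_structure]).

The curvature of [D + Gamma] on [(al, be)] multiplies [al] by [- (3 + lam + rho)]
and [be] by its opposite, so flatness means [lam + rho + 3 = 0] ([flat_relation]).
This is impossible on an open set ([overdetermined]). The functions satisfy
[al(lam) = - lam (rho + 2)], [be(rho) = - rho (lam + 2)] and
[al(rho) = rho (1 + 2 rho + rho tau)], with a further function [tau] for which
[be(tau) = tau - 3 / rho]. Differentiating the relation along [al] expresses
[rho^2 tau] through [rho]; differentiating the result along [be] leaves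
[(rho + 1) (rho + 2) = 0]. So [rho] is locally constant, while at both values one
of the two derivatives of [rho] above is nonzero.

For an arbitrary representative of the structure-germ, connectedness of the leaves
near [p0] puts the tangent spaces of its foliations inside the lines spanned by
[al] and [be], and transversality makes them equal; hence the argument applies to
it ([never_flat]). *)

(** * Determinants in the plane *)

Section Det.
Context {R : realType}.
Implicit Types (u v w z : R * R) (c : R).

Lemma pair_eq v w : v.1 = w.1 -> v.2 = w.2 -> v = w.
Proof. by case: v w => [? ?] [? ?] /= -> ->. Qed.

Definition det v w : R := v.1 * w.2 - v.2 * w.1.

Lemma detvv v : det v v = 0.
Proof. by rewrite /det mulrC subrr. Qed.

Lemma detC v w : det v w = - det w v.
Proof. by rewrite /det; ring. Qed.

Lemma detDl u v w : det (u + v) w = det u w + det v w.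
Proof. by rewrite /det /=; ring. Qed.

Lemma detBl u v w : det (u - v) w = det u w - det v w.
Proof. by rewrite /det /=; ring. Qed.
Lemma detBr u v w : det w (u - v) = det w u - det w v.
Proof. by rewrite /det /=; ring. Qed.
Lemma detZl c u w : det (c *: u) w = c * det u w.
Proof. by rewrite /det /= /GRing.scale /=; ring. Qed.
Lemma detZr c u w : det w (c *: u) = c * det w u.
Proof. by rewrite /det /= /GRing.scale /=; ring. Qed.
Lemma det0l w : det 0 w = 0. Proof. by rewrite /det /=; ring. Qed.
Lemma det0r w : det w 0 = 0. Proof. by rewrite /det /=; ring. Qed.

Lemma proportional u v w : det u v != 0 -> det u w = 0 -> w = (det w v / det u v) *: u.
Proof.
move=> uv uw; have E i j : (det w v) * i = det u v * j -> j = det w v / det u v * i.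
  by move=> h; apply: (mulfI uv); rewrite -h mulrA mulrCA divff // mulr1.
apply: pair_eq; apply: E.
  by apply/eqP; rewrite -subr_eq0; apply/eqP; rewrite -[RHS](mul0r (- v.1)) -uw /det; ring.
by apply/eqP; rewrite -subr_eq0; apply/eqP; rewrite -[RHS](mul0r (- v.2)) -uw /det; ring.
Qed.

Lemma det_nondegenerate u : (forall z, det z u = 0) -> u = 0.
Proof.
move=> h; apply: pair_eq.
  by have := h (0, - 1); rewrite /det /= mul0r sub0r mulN1r opprK.
by have := h (1, 0); rewrite /det /= mul1r mul0r subr0.
Qed.

(** If [det u w = 0] then [u] and [w] are orthogonal for [det] to all their combinations,
   hence to the whole plane, so both vanish. *)
Lemma transverse_det u w : transverse (line_span u) (line_span w) -> det u w != 0.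
Proof.
move=> tr; apply/eqP => uw0.
have dec z : exists c d, z = c *: u + d *: w.
  by have [_ [_ [[c _ <-] [d _ <-] ->]]] := tr z; exists c, d.
have u0 : u = 0.
  apply: det_nondegenerate => z; have [c [d ->]] := dec z.
  by rewrite detDl !detZl detvv (detC w) uw0 oppr0 !mulr0 addr0.
have w0 : w = 0.
  apply: det_nondegenerate => z; have [c [d ->]] := dec z.
  by rewrite detDl !detZl detvv uw0 !mulr0 addr0.
have [c [d /(congr1 fst) /=]] := dec (1, 0).
by rewrite u0 w0 !scaler0 /= addr0 => /eqP; rewrite oner_eq0.
Qed.

End Det.

(** * Maps of class C^k *)

Section NearEq.
Context {R : realType} {E E' : normedModType R}.

Lemma near_eq_differentiable (f g : E -> E') x :
  (\forall y \near x, f y = g y) -> differentiable f x -> differentiable g x.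
Proof.
move=> fg df.
have fgx : f x = g x by exact: nbhs_singleton fg.
have fg0 : \forall y \near (0 : E), f (y + x) = g (y + x).
  move: fg; rewrite (near_shift 0 x) /=; apply: filterS => y /=.
  by rewrite subr0.
have H : g \o shift x = cst (g x) + 'd f x +o_ 0 id.
  apply/eqaddoP => e e0.
  have /eqaddoP/(_ e e0) := diff_locally df.
  apply: filter_app; apply: filterS fg0 => y fgy /=.
  by rewrite !fctE /= fgx fgy.
have C : continuous ('d f x) by exact: diff_continuous.
apply/diff_locallyP; rewrite (diff_unique C H); split => //.
Qed.

End NearEq.

Section Linear.
Context {R : realType}.
Lemma fst_differentiable (E' E'' : normedModType R) x : differentiable (@fst E' E'') x.
Proof. by apply: linear_differentiable => ?; apply: cvg_fst. Qed.
Lemma snd_differentiable (E' E'' : normedModType R) x : differentiable (@snd E' E'') x.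
Proof. by apply: linear_differentiable => ?; apply: cvg_snd. Qed.
Lemma derive_fst (E E' E'' : normedModType R) (f : E -> E' * E'') x v :
  differentiable f x -> 'D_v (fun y => (f y).1) x = ('D_v f x).1.
Proof.
move=> df; rewrite !deriveE //; last exact: differentiable_comp df (fst_differentiable _).
rewrite (diff_comp df (fst_differentiable _)) /= diff_lin //.
by move=> ?; apply: cvg_fst.
Qed.
Lemma derive_snd (E E' E'' : normedModType R) (f : E -> E' * E'') x v :
  differentiable f x -> 'D_v (fun y => (f y).2) x = ('D_v f x).2.
Proof.
move=> df; rewrite !deriveE //; last exact: differentiable_comp df (snd_differentiable _).
rewrite (diff_comp df (snd_differentiable _)) /= diff_lin //.
by move=> ?; apply: cvg_snd.
Qed.
Lemma derive_pair (E E' E'' : normedModType R) (f : E -> E') (g : E -> E'') x v :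
  differentiable f x -> differentiable g x ->
  'D_v (fun y => (f y, g y)) x = ('D_v f x, 'D_v g x).
Proof.
move=> df dg; rewrite !deriveE //; last exact: differentiable_pair.
by rewrite diff_pair.
Qed.
Lemma derive_comp (E E' : normedModType R) (f : E -> R) (g : R -> E') x v :
  differentiable f x -> differentiable g (f x) ->
  'D_v (g \o f) x = 'D_v f x *: 'D_1 g (f x).
Proof.
move=> df dg; have dgf : differentiable (g \o f) x by exact: differentiable_comp.
by rewrite (deriveE v dgf) (diff_comp df dg) /= diff1E // (deriveE v df) derive1E.
Qed.
End Linear.

Section Ck.
Context {R : realType} {E : normedModType R}.
Implicit Types (V W : set E) (k : nat).

Lemma Ck_sub {E' : normedModType R} k V W (f : E -> E') :
  W `<=` V -> is_Ck k V f -> is_Ck k W f.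
Proof.
move=> WV; elim: k f => [|k IH] f /=; first by move=> fV x /WV; exact: fV.
by move=> [df fV]; split => [x /WV /df //|v]; exact: IH.
Qed.

Lemma Ck_ext {E' : normedModType R} k V (f g : E -> E') :
  open V -> (forall x, V x -> f x = g x) -> is_Ck k V f -> is_Ck k V g.
Proof.
move=> oV; elim: k f g => [|k IH] f g fg /=.
  move=> fV x Vx.
  have fgx : \forall y \near x, f y = g y.
    by apply: filterS fg _; exact: open_nbhs_nbhs.
  rewrite /prop_for /continuous_at -(fg x Vx).
  by apply: cvg_trans (fV x Vx); exact: near_eq_cvg.
move=> [df fV]; split => [x Vx|v].
  apply: near_eq_differentiable (df x Vx).
  by apply: filterS fg _; exact: open_nbhs_nbhs.
apply: IH (fV v) => x Vx; apply: near_eq_derive.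
by apply: filterS fg _; exact: open_nbhs_nbhs.
Qed.

Lemma CkW {E' : normedModType R} k V (f : E -> E') :
  is_Ck k.+1 V f -> is_Ck k V f.
Proof.
elim: k f => [|k IH] f [df fV] /=.
  by move=> x /df; exact: differentiable_continuous.
by split => // v; exact: IH.
Qed.

Lemma Ck_cst {E' : normedModType R} k V (c : E') : is_Ck k V (fun=> c).
Proof.
elim: k c => [|k IH] c /=; first by move=> x _; exact: cst_continuous.
split=> [x _|v]; first exact: differentiable_cst.
by under eq_fun => x do rewrite derive_cst; exact: IH.
Qed.

Lemma Ck_linear {E' : normedModType R} k V (f : {linear E -> E'}) :
  continuous f -> is_Ck k V f.
Proof.
move=> cf; case: k => [|k]; first by move=> x _; exact: cf.
split=> [x _|v]; first exact: linear_differentiable.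
suff -> : (fun x => 'D_v f x) = (fun=> f v) by exact: Ck_cst.
by apply/funext => x; rewrite deriveE ?diff_lin //; exact: linear_differentiable.
Qed.

Lemma Ck_pair {E1 E2 : normedModType R} k V (f : E -> E1) (g : E -> E2) :
  open V -> is_Ck k V f -> is_Ck k V g -> is_Ck k V (fun x => (f x, g x)).
Proof.
move=> oV; elim: k f g => [|k IH] f g.
  by move=> fV gV x Vx; apply: cvg_pair; [exact: fV|exact: gV].
move=> [df fV] [dg gV]; split=> [x Vx|v].
  by apply: differentiable_pair; [exact: df|exact: dg].
apply: Ck_ext (IH _ _ (fV v) (gV v)) => // x Vx.
by rewrite derive_pair //; [exact: df|exact: dg].
Qed.

Lemma Ck_fst {E1 E2 : normedModType R} k V (f : E -> E1 * E2) :
  open V -> is_Ck k V f -> is_Ck k V (fun x => (f x).1).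
Proof.
move=> oV; elim: k f => [|k IH] f.
  by move=> fV x Vx; apply: continuous_comp; [exact: fV|exact: cvg_fst].
move=> [df fV]; split=> [x Vx|v].
  exact: differentiable_comp (df x Vx) (fst_differentiable _).
apply: Ck_ext (IH _ (fV v)) => // x Vx.
by rewrite derive_fst //; exact: df.
Qed.

Lemma Ck_snd {E1 E2 : normedModType R} k V (f : E -> E1 * E2) :
  open V -> is_Ck k V f -> is_Ck k V (fun x => (f x).2).
Proof.
move=> oV; elim: k f => [|k IH] f.
  by move=> fV x Vx; apply: continuous_comp; [exact: fV|exact: cvg_snd].
move=> [df fV]; split=> [x Vx|v].
  exact: differentiable_comp (df x Vx) (snd_differentiable _).
apply: Ck_ext (IH _ (fV v)) => // x Vx.
by rewrite derive_snd //; exact: df.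
Qed.

Lemma CkD {E' : normedModType R} k V (f g : E -> E') : open V ->
  is_Ck k V f -> is_Ck k V g -> is_Ck k V (fun x => f x + g x).
Proof.
move=> oV; elim: k f g => [|k IH] f g.
  by move=> fV gV x Vx; apply: continuousD; [exact: fV|exact: gV].
move=> [df fV] [dg gV]; split=> [x Vx|v].
  by apply: differentiableD; [exact: df|exact: dg].
apply: Ck_ext (IH _ _ (fV v) (gV v)) => // x Vx.
by rewrite (@deriveD _ _ _ f g) //; apply: diff_derivable; [exact: df|exact: dg].
Qed.

Lemma CkM k V (f g : E -> R) : open V ->
  is_Ck k V f -> is_Ck k V g -> is_Ck k V (fun x => f x * g x).
Proof.
move=> oV; elim: k f g => [|k IH] f g.
  by move=> fV gV x Vx; apply: continuousM; [exact: fV|exact: gV].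
move=> fk gk; have [df fV] := fk; have [dg gV] := gk; split=> [x Vx|v].
  by apply: differentiableM; [exact: df|exact: dg].
apply: Ck_ext (CkD oV (IH _ _ (CkW fk) (gV v)) (IH _ _ (CkW gk) (fV v))) => // x Vx.
by rewrite (@deriveM _ _ f g) //; apply: diff_derivable; [exact: df|exact: dg].
Qed.

Lemma CkN k V (f : E -> R) : open V -> is_Ck k V f -> is_Ck k V (fun x => - f x).
Proof.
move=> oV fV; have := CkM oV (Ck_cst k V (-1 : R)) fV.
by under eq_fun do rewrite mulN1r.
Qed.

Lemma CkB k V (f g : E -> R) : open V ->
  is_Ck k V f -> is_Ck k V g -> is_Ck k V (fun x => f x - g x).
Proof. by move=> oV fV gV; apply: CkD => //; exact: CkN. Qed.

(** Induction: the derivative of [1 / f] is [- (1 / f)^2] times that of [f], and the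
   first factor is known to be of class C^k at this stage. *)
Lemma CkV k V (f : E -> R) : open V -> (forall x, V x -> f x != 0) ->
  is_Ck k V f -> is_Ck k V (fun x => (f x)^-1).
Proof.
move=> oV f0; elim: k => [|k IH].
  by move=> fV x Vx; apply: continuousV; [exact: f0|exact: fV].
move=> fk; have [df fV] := fk; split=> [x Vx|v].
  by apply: differentiableV; [exact: df|exact: f0].
have fi := IH (CkW fk).
apply: Ck_ext (CkM oV (CkN oV (CkM oV fi fi)) (fV v)) => // x Vx.
rewrite (@deriveV _ _ f) ?f0 //; last by apply: diff_derivable; exact: df.
by rewrite expr2 invfM.
Qed.

End Ck.

Section CkR.
Context {R : realType} {E : normedModType R}.

(** The derivative of [g \o f] along [v] is the product of the derivative of [f] along
   [v] and of [g' \o f], so composition with a function of one variable reduces by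
   induction to products. *)
Lemma Ck_comp k (I : set R) (V : set E) (g : R -> R) (f : E -> R) : open V ->
  (forall x, V x -> I (f x)) -> is_Ck k I g -> is_Ck k V f ->
  is_Ck k V (fun x => g (f x)).
Proof.
move=> oV fI; elim: k g => [|k IH] g.
  by move=> gI fV x Vx; apply: continuous_comp; [exact: fV|apply: gI; exact: fI].
move=> gk fk; have [dg gI] := gk; have [df fV] := fk; split=> [x Vx|v].
  by apply: differentiable_comp; [exact: df|apply: dg; exact: fI].
apply: Ck_ext (CkM oV (fV v) (IH _ (gI 1) (CkW fk))) => // x Vx.
rewrite (derive_comp (f := f) (g := g)) //; [exact: df|apply: dg; exact: fI].
Qed.

End CkR.

Section CkPlane.
Context {R : realType} {E : normedModType R}.
Implicit Types (V : set E) (k : nat).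

Lemma Ck_det k V (f g : E -> R * R) : open V ->
  is_Ck k V f -> is_Ck k V g -> is_Ck k V (fun x => det (f x) (g x)).
Proof.
move=> oV fV gV.
by apply: CkB => //; apply: CkM => //;
  [exact: Ck_fst|exact: Ck_snd|exact: Ck_snd|exact: Ck_fst].
Qed.

Lemma Ck_scale k V (f : E -> R) (g : E -> R * R) : open V ->
  is_Ck k V f -> is_Ck k V g -> is_Ck k V (fun x => f x *: g x).
Proof.
move=> oV fV gV.
have h := Ck_pair oV (CkM oV fV (Ck_fst oV gV)) (CkM oV fV (Ck_snd oV gV)).
exact: Ck_ext h.
Qed.

Lemma CkB_pair k V (f g : E -> R * R) : open V ->
  is_Ck k V f -> is_Ck k V g -> is_Ck k V (fun x => f x - g x).
Proof.
move=> oV fV gV.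
have h := Ck_pair oV (CkB oV (Ck_fst oV fV) (Ck_fst oV gV))
                     (CkB oV (Ck_snd oV fV) (Ck_snd oV gV)).
exact: Ck_ext h.
Qed.

Lemma Ck_curve k (I : set R) V (g : R -> R * R) (f : E -> R) :
  open I -> open V -> (forall x, V x -> I (f x)) ->
  is_Ck k I g -> is_Ck k V f -> is_Ck k V (fun x => g (f x)).
Proof.
move=> oI oV fI gI fV.
have h := Ck_pair oV (Ck_comp oV fI (Ck_fst oI gI) fV)
                     (Ck_comp oV fI (Ck_snd oI gI) fV).
by apply: Ck_ext h => // x _; case: (g (f x)).
Qed.

Lemma Ck_id k V : is_Ck k V id.
Proof. by apply: (@Ck_linear _ _ _ _ _ idfun) => x. Qed.

Lemma smooth_derive {E' : normedModType R} V (f : E -> E') (v : E) :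
  smooth_on V f -> smooth_on V (fun x => 'D_v f x).
Proof. by move=> fV k; have [_] := fV k.+1; exact. Qed.

Lemma smooth_continuous {E' : normedModType R} V (f : E -> E') x :
  smooth_on V f -> V x -> {for x, continuous f}.
Proof. by move=> /(_ 0%N); apply. Qed.

Lemma smooth_differentiable {E' : normedModType R} V (f : E -> E') x :
  smooth_on V f -> V x -> differentiable f x.
Proof. by move=> /(_ 1%N) []; auto. Qed.

End CkPlane.

(** Smoothness of an explicit expression. Choosing the closure lemma by the head
   symbol avoids higher-order unification against every lemma in turn, which is
   slow because these predicates unfold. *)
Ltac ck :=
  first
  [ match goal with
    | H : ?A |- ?B => constr_eq A B; exact: H
    | H : smooth_on _ ?f |- is_Ck _ _ ?g => constr_eq f g; exact: H
    end
  | lazymatch goal with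
  | |- is_Ck _ _ (fun x => det (@?f x) (@?g x)) => apply: (Ck_det (f := f) (g := g)); ck
  | |- is_Ck _ _ (fun x => GRing.add (@?f x) (GRing.opp (@?g x))) =>
      first [ let _ := constr:(fun x => fst (f x)) in apply: (CkB_pair (f := f) (g := g))
            | apply: (CkB (f := f) (g := g)) ]; ck
  | |- is_Ck _ _ (fun x => GRing.add (@?f x) (@?g x)) => apply: (CkD (f := f) (g := g)); ck
  | |- is_Ck _ _ (fun x => GRing.opp (@?f x)) => apply: (CkN (f := f)); ck
  | |- is_Ck _ _ (fun x => GRing.mul (@?f x) (@?g x)) => apply: (CkM (f := f) (g := g)); ck
  | |- is_Ck _ _ (fun x => GRing.inv (@?f x)) => apply: (CkV (f := f)); ck
  | |- is_Ck _ _ (fun x => GRing.scale (@?f x) (@?g x)) => apply: (Ck_scale (f := f) (g := g)); ck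
  | |- is_Ck _ _ (fun x => (@?f x, @?g x)) => apply: (Ck_pair (f := f) (g := g)); ck
  | |- is_Ck _ _ (fun x => (@?f x).1) => apply: (Ck_fst (f := f)); ck
  | |- is_Ck _ _ (fun x => (@?f x).2) => apply: (Ck_snd (f := f)); ck
  | |- is_Ck _ _ (fun x => x) => exact: Ck_id
  | _ => first [ exact: Ck_cst | assumption
               | match goal with H : smooth_on _ _ |- _ => exact: H end | idtac ]
  end ].

Section Sets.
Context {R : realType} {E : normedModType R}.
Lemma open_gt0_in (V : set E) (f : E -> R) : open V ->
  (forall x, V x -> {for x, continuous f}) -> open (V `&` [set x | 0 < f x]).
Proof.
move=> oV cf; rewrite openE => x [Vx fx].
apply: filterI; first exact: open_nbhs_nbhs.
apply: (cf x Vx [set y | 0 < y]); by apply: open_nbhs_nbhs; split=> //.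
Qed.

Lemma open_neq0_in (V : set E) (f : E -> R) : open V ->
  (forall x, V x -> {for x, continuous f}) -> open (V `&` [set x | f x != 0]).
Proof.
move=> oV cf; rewrite openE => x [Vx fx].
apply: filterI; first exact: open_nbhs_nbhs.
apply: (cf x Vx [set y | y != 0]); by apply: open_nbhs_nbhs; split=> //.
Qed.
End Sets.

(** * Rules of differentiation *)

Section DetDerive.
Context {R : realType} {E : normedModType R}.

Lemma differentiable_det (f g : E -> R * R) x :
  differentiable f x -> differentiable g x ->
  differentiable (fun y => det (f y) (g y)) x.
Proof.
move=> df dg.
have f1 := differentiable_comp df (fst_differentiable (f x)).
have f2 := differentiable_comp df (snd_differentiable (f x)).
have g1 := differentiable_comp dg (fst_differentiable (g x)).
have g2 := differentiable_comp dg (snd_differentiable (g x)).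
exact: differentiableB (differentiableM f1 g2) (differentiableM f2 g1).
Qed.

Lemma derive_det (f g : E -> R * R) x v :
  differentiable f x -> differentiable g x ->
  'D_v (fun y => det (f y) (g y)) x = det ('D_v f x) (g x) + det (f x) ('D_v g x).
Proof.
move=> df dg.
have f1 := @diff_derivable _ _ _ _ _ v (differentiable_comp df (fst_differentiable (f x))).
have f2 := @diff_derivable _ _ _ _ _ v (differentiable_comp df (snd_differentiable (f x))).
have g1 := @diff_derivable _ _ _ _ _ v (differentiable_comp dg (fst_differentiable (g x))).
have g2 := @diff_derivable _ _ _ _ _ v (differentiable_comp dg (snd_differentiable (g x))).
have := deriveB (derivableM f1 g2) (derivableM f2 g1).
rewrite (deriveM f1 g2) (deriveM f2 g1).
rewrite [X in _ *: X + _ - _](derive_snd v dg) [X in _ + _ *: X - _](derive_fst v df).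
rewrite [X in _ - (_ *: X + _)](derive_fst v dg) [X in _ - (_ + _ *: X)](derive_snd v df).
move=> /= H; rewrite [LHS]H /det /GRing.scale /=; ring.
Qed.
End DetDerive.

Section Pairs.
Context {R : realType}.

Lemma differentiable_scale {E : normedModType R} (f : E -> R) (g : E -> R * R) x :
  differentiable f x -> differentiable g x -> differentiable (fun q => f q *: g q) x.
Proof.
move=> df dg.
have g1 := differentiable_comp dg (fst_differentiable (g x)).
have g2 := differentiable_comp dg (snd_differentiable (g x)).
exact: differentiable_pair (differentiableM df g1) (differentiableM df g2).
Qed.

Lemma derive_scale {E : normedModType R} (f : E -> R) (g : E -> R * R) x v :
  differentiable f x -> differentiable g x ->
  'D_v (fun q => f q *: g q) x = 'D_v f x *: g x + f x *: 'D_v g x.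
Proof.
move=> df dg.
have dg1 := differentiable_comp dg (fst_differentiable (g x)).
have dg2 := differentiable_comp dg (snd_differentiable (g x)).
have := derive_pair v (differentiableM df dg1) (differentiableM df dg2).
rewrite (deriveM (@diff_derivable _ _ _ _ _ v df) (@diff_derivable _ _ _ _ _ v dg1)).
rewrite (deriveM (@diff_derivable _ _ _ _ _ v df) (@diff_derivable _ _ _ _ _ v dg2)).
rewrite [in (_, _)](derive_fst v dg) [in (_, _)](derive_snd v dg) => H.
rewrite [LHS]H; apply: pair_eq; rewrite /= /GRing.scale /=; ring.
Qed.

Lemma derive_div {E : normedModType R} (f g : E -> R) x v :
  differentiable f x -> differentiable g x -> g x != 0 ->
  'D_v (fun q => f q / g q) x = ('D_v f x * g x - f x * 'D_v g x) / g x ^+ 2.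
Proof.
move=> df dg g0.
have dgi := differentiableV dg g0.
rewrite (deriveM (@diff_derivable _ _ _ _ _ v df) (@diff_derivable _ _ _ _ _ v dgi)).
rewrite (deriveV g0 (@diff_derivable _ _ _ _ _ v dg)) /GRing.scale /=; by field.
Qed.

End Pairs.

Section HasDerive.
Context {R : realType} {E : normedModType R}.
Implicit Types (p v : E).

(** Differentiability and the value of one directional derivative, kept together so
   that the derivative of a compound expression is assembled from those of its
   parts. *)
Definition has_derive {E' : normedModType R} p v (f : E -> E') (df : E') :=
  differentiable f p /\ 'D_v f p = df.

Lemma has_derive_eq {E' : normedModType R} p v (f : E -> E') df df' :
  has_derive p v f df -> df = df' -> has_derive p v f df'.
Proof. by move=> h <-. Qed.

Lemma has_derive_det p v (f g : E -> R * R) df dg :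
  has_derive p v f df -> has_derive p v g dg ->
  has_derive p v (fun q => det (f q) (g q)) (det df (g p) + det (f p) dg).
Proof.
move=> [f1 <-] [g1 <-]; split; first exact: differentiable_det.
exact: derive_det.
Qed.

Lemma has_deriveM p v (f g : E -> R) df dg :
  has_derive p v f df -> has_derive p v g dg ->
  has_derive p v (fun q => f q * g q) (df * g p + f p * dg).
Proof.
move=> [f1 <-] [g1 <-]; split; first exact: differentiableM f1 g1.
have := deriveM (@diff_derivable _ _ _ _ _ v f1) (@diff_derivable _ _ _ _ _ v g1).
rewrite /GRing.scale /= addrC => h; rewrite [LHS]h; congr (_ + _); exact: mulrC.
Qed.

Lemma has_derive_div p v (f g : E -> R) df dg :
  has_derive p v f df -> has_derive p v g dg -> g p != 0 ->
  has_derive p v (fun q => f q / g q) ((df * g p - f p * dg) / g p ^+ 2).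
Proof.
move=> [f1 <-] [g1 <-] g0; split.
  exact: differentiableM f1 (differentiableV g1 g0).
exact: derive_div.
Qed.

Lemma has_deriveD {E' : normedModType R} p v (f g : E -> E') df dg :
  has_derive p v f df -> has_derive p v g dg ->
  has_derive p v (fun q => f q + g q) (df + dg).
Proof.
move=> [f1 <-] [g1 <-]; split; first exact: differentiableD f1 g1.
exact: deriveD (@diff_derivable _ _ _ _ _ v f1) (@diff_derivable _ _ _ _ _ v g1).
Qed.

Lemma has_deriveN {E' : normedModType R} p v (f : E -> E') df :
  has_derive p v f df -> has_derive p v (fun q => - f q) (- df).
Proof.
move=> [f1 <-]; split; first exact: differentiableN f1.
exact: deriveN (@diff_derivable _ _ _ _ _ v f1).
Qed.

Lemma has_deriveB {E' : normedModType R} p v (f g : E -> E') df dg :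
  has_derive p v f df -> has_derive p v g dg ->
  has_derive p v (fun q => f q - g q) (df - dg).
Proof. by move=> hf hg; exact: has_deriveD hf (has_deriveN hg). Qed.

Lemma has_derive_id p v : has_derive p v (fun q => q) v.
Proof. by split; [exact: ex_diff|exact: derive_id]. Qed.

Lemma has_derive_cst {E' : normedModType R} p v (c : E') : has_derive p v (fun=> c) 0.
Proof. by split; [exact: differentiable_cst|exact: derive_cst]. Qed.

Lemma has_derive_curve p v (g : R -> R * R) (f : E -> R) df :
  has_derive p v f df -> differentiable g (f p) ->
  has_derive p v (fun q => g (f q)) (df *: 'D_1 g (f p)).
Proof.
move=> [f1 <-] dg; split; first exact: differentiable_comp f1 dg.
exact: derive_comp.
Qed.

Lemma has_derive_curve0 p v (g : R -> R * R) (f : E -> R) :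
  has_derive p v f 0 -> differentiable g (f p) -> has_derive p v (fun q => g (f q)) 0.
Proof. by move=> hf /(has_derive_curve hf); rewrite scale0r. Qed.

(** Extracts the differential consequences of an identity valid on an open set. *)
Lemma has_derive_zero (V : set E) p v (f : E -> R) df : open V -> V p ->
  (forall q, V q -> f q = 0) -> has_derive p v f df -> df = 0.
Proof.
move=> oV Vp f0 [_ <-].
have -> : 'D_v f p = 'D_v (fun=> 0 : R) p.
  by apply: near_eq_derive; apply: filterS f0 _; exact: open_nbhs_nbhs.
exact: derive_cst.
Qed.

End HasDerive.

(** * An implicit function theorem *)

Lemma dist_lt_between {R : realType} (a e s t x : R) :
  `|s - a| < e -> `|t - a| < e -> s <= x <= t -> `|x - a| < e.
Proof. by rewrite !ltr_norml => sa ta sxt; lra. Qed.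

Section Ratio.
Context {R : realType} {E : normedModType R}.
(** The mean value theorem presents the increment of an implicit function exactly as
   [kappa q * l (q - p)], with [kappa q] tending to 1; this turns such a formula into
   differentiability. *)
Lemma differentiable_ratio (f kappa : E -> R) (l : {linear E -> R}) (p : E) :
  continuous l -> kappa @ p --> (1 : R) ->
  (\forall q \near p, f q - f p = kappa q * l (q - p)) ->
  differentiable f p /\ forall v, 'D_v f p = l v.
Proof.
move=> cl ck fl.
suff H : f \o shift p = cst (f p) + l +o_ 0 id.
  have dl := diff_unique cl H.
  have df : differentiable f p by apply/diff_locallyP; rewrite dl.
  by split=> // v; rewrite deriveE // dl.
have [k k0 lk] : exists2 k, k > 0 & forall x, `|l x| <= k * `|x|.
  exact: linear_lipschitz.
apply/eqaddoP => e e0.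
have ek : 0 < e / k by exact: divr_gt0.
have fl0 : \forall h \near (0 : E), f (h + p) - f p = kappa (h + p) * l h.
  move: fl; rewrite (near_shift 0 p) /=; apply: filterS => h /=.
  by rewrite subr0 addrK.
have ck0 : \forall h \near (0 : E), `|1 - kappa (h + p)| < e / k.
  have ck1 : \forall x \near p, `|1 - kappa x| < e / k by move/cvgrPdist_lt: ck; exact.
  move: ck1; rewrite (near_shift 0 p) /=.
  by apply: filterS => h /=; rewrite subr0.
near=> h.
have -> : (f \o shift p - (cst (f p) + l)) h = (kappa (h + p) - 1) * l h.
  rewrite !fctE /= opprD addrA.
  have -> : f (h + p) - f p = kappa (h + p) * l h by near: h.
  by rewrite mulrBl mul1r.
rewrite normrM distrC.
apply: le_trans (_ : e / k * (k * `|h|) <= _); last first.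
  by rewrite mulrA divfK // gt_eqF.
apply: ler_pM => //; apply: ltW; near: h; exact: ck0.
Unshelve. all: by end_near. Qed.
End Ratio.

Section ImplicitFunction.
Context {R : realType} {E : normedModType R}.
Variables (H Hs : E -> R -> R) (l : R -> {linear E -> R}).
Variables (N : set E) (p0 : E) (a e : R).
Hypotheses (Np0 : nbhs p0 N) (e0 : 0 < e) (H0 : H p0 a = 0).
Hypothesis dH : forall p s, N p -> `|s - a| < e -> is_derive s 1 (H p) (Hs p s).
Hypothesis Hs_gt0 : forall p s, N p -> `|s - a| < e -> 0 < Hs p s.
Hypothesis cHs : forall p s, N p -> `|s - a| < e ->
  {for (p, s), continuous (fun z : E * R => Hs z.1 z.2)}.
Hypothesis cl : forall s, continuous (l s).
Hypothesis HB : forall p q s, H q s - H p s = l s (q - p).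
Implicit Types (p q v : E) (s t : R).

Lemma implicit_mvt p s t : N p -> `|s - a| < e -> `|t - a| < e ->
  exists x, [/\ `|x - a| < e, `|x - s| <= `|t - s| & H p t - H p s = Hs p x * (t - s)].
Proof.
move=> Np.
have main s' t' : `|s' - a| < e -> `|t' - a| < e -> s' <= t' ->
    exists2 x, s' <= x <= t' & H p t' - H p s' = Hs p x * (t' - s').
  move=> sa ta st.
  have Ist x : s' <= x <= t' -> `|x - a| < e by exact: dist_lt_between.
  have := @MVT_segment _ (H p) (Hs p) s' t' st; case.
  - by move=> x; rewrite in_itv /= => xst; apply: dH => //; apply: Ist; lra.
  - apply: derivable_within_continuous => x; rewrite in_itv /= => xst.
    by have [] := dH Np (Ist x xst).
  by move=> x; rewrite in_itv /= => xst Ex; exists x.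
move=> sa ta; have [st|/ltW ts] := leP s t.
  have [x xst Ex] := main _ _ sa ta st; exists x; split => //.
    exact: dist_lt_between xst.
  by case/andP: xst => sx xt; rewrite !ger0_norm ?subr_ge0 // lerD2r.
have [x xst Ex] := main _ _ ta sa ts; exists x; split => //.
  exact: dist_lt_between xst.
  by case/andP: xst => tx xs; rewrite !ler0_norm ?subr_le0 // !opprB lerD2l lerN2.
by rewrite -[LHS]opprB Ex; ring.
Qed.

Lemma implicit_mono p s t : N p -> `|s - a| < e -> `|t - a| < e -> s < t -> H p s < H p t.
Proof.
move=> Np sa ta st; have [x [xa _ Ex]] := implicit_mvt Np sa ta.
have Hx := Hs_gt0 Np xa.
by rewrite -subr_gt0 Ex mulr_gt0 // subr_gt0.
Qed.

Let d := e / 2.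
Let W := (interior N `&` [set p | 0 < - H p (a - d)]) `&` [set p | 0 < H p (a + d)].
Let d0 : 0 < d. Proof. by rewrite /d divr_gt0. Qed.
Let de : d < e. Proof. by rewrite ltr_pdivrMr // ltr_pMr // ltr1n. Qed.
Let aLe : `|a - d - a| < e.
Proof. by rewrite addrAC subrr sub0r normrN gtr0_norm. Qed.
Let aRe : `|a + d - a| < e.
Proof. by rewrite addrAC subrr add0r gtr0_norm. Qed.

Let cont_H p s : {for p, continuous (fun q => H q s)}.
Proof.
have -> : (fun q => H q s) = (fun q => H p s + l s (q - p)).
  by apply/funext => q; rewrite -HB addrC subrK.
apply: continuousD; first exact: cst_continuous.
apply: continuous_comp; last exact: cl.
by apply: continuousB; [exact: cvg_id|exact: cst_continuous].
Qed.

Let oW : open W.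
Proof.
apply: open_gt0_in => [|p _]; last exact: cont_H.
apply: open_gt0_in => [|p _]; first exact: open_interior.
by apply: continuousN; exact: cont_H.
Qed.

Let WN p : W p -> N p. Proof. by move=> [[/interior_subset]]. Qed.

Let Wp0 : W p0.
Proof.
have Np : N p0 by exact: nbhs_singleton.
have Ha := H0.
have aa : `|a - a| < e by rewrite subrr normr0.
split; first split => //=.
  rewrite oppr_gt0 -Ha. apply: implicit_mono => //; rewrite gtrBl; exact: d0.
by rewrite /= -Ha; apply: implicit_mono => //; rewrite ltrDl; exact: d0.
Qed.

Let root_exists p : W p -> exists s, `|s - a| < d /\ H p s = 0.
Proof.
move=> Wp; have Np := WN Wp; have [[_ /= Hl] /= Hr] := Wp.
have lr : a - d <= a + d by rewrite lerD2l ge0_cp // ltW.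
have [| |x xI Hx] := @IVT _ (H p) (a - d) (a + d) 0 lr.
- apply: derivable_within_continuous => x; rewrite in_itv /= => xst.
  have xa : `|x - a| < e by exact: dist_lt_between xst.
  by have [] := dH Np xa.
- by rewrite ge_min le_max; apply/andP; split; apply/orP; [left|right]; lra.
exists x; split=> //; move: xI; rewrite in_itv /= => /andP[xl xr].
have xl' : x != a - d by apply/eqP => Ex; move: Hx Hl; rewrite Ex; lra.
have xr' : x != a + d by apply/eqP => Ex; move: Hx Hr; rewrite Ex; lra.
move: xl xr; rewrite !le_eqVlt (eq_sym _ x) (negbTE xl') (negbTE xr') /=.
by rewrite ltr_norml; lra.
Qed.

Let S p := xget 0 [set s | `|s - a| < d /\ H p s = 0].
Let S_root p : W p -> `|S p - a| < d /\ H p (S p) = 0.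
Proof. by move=> /root_exists [s ps]; rewrite /S; case: xgetP => [y _|/(_ s)]. Qed.
Let S_e p : W p -> `|S p - a| < e.
Proof. by move=> /S_root [h _]; exact: lt_trans de. Qed.

Let S_uniq p s : W p -> `|s - a| < d -> H p s = 0 -> s = S p.
Proof.
move=> Wp sa Hp; have [Sa HS] := S_root Wp; have Np := WN Wp.
have se : `|s - a| < e by exact: lt_trans de.
have := S_e Wp => Se.
have [lt|lt|//] := ltgtP s (S p).
  by have := implicit_mono Np se Se lt; rewrite Hp HS ltxx.
by have := implicit_mono Np Se se lt; rewrite Hp HS ltxx.
Qed.

Let S_cont p : W p -> {for p, continuous S}.
Proof.
move=> Wp; have Np := WN Wp; have [Sa HS] := S_root Wp; have Se := S_e Wp.
apply/cvgrPdist_lt => eps eps0.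
pose r := Num.min eps (e - `|S p - a|).
have r0 : 0 < r by rewrite lt_min eps0 subr_gt0.
have [re ra] : r <= eps /\ r <= e - `|S p - a|.
  by split; rewrite /r ge_min lexx ?orbT.
pose h := r / 2.
have h0 : 0 < h by rewrite /h divr_gt0.
have hr : h < r by rewrite /h; lra.
have le : `|S p - h - a| < e.
  rewrite addrAC; apply: le_lt_trans (ler_normB _ _) _.
  by rewrite (gtr0_norm h0); lra.
have ri : `|S p + h - a| < e.
  rewrite addrAC; apply: le_lt_trans (ler_normD _ _) _.
  by rewrite (gtr0_norm h0); lra.
have Hl : H p (S p - h) < 0 by rewrite -HS; apply: implicit_mono => //; lra.
have Hr : 0 < H p (S p + h) by rewrite -HS; apply: implicit_mono => //; lra.
have nl : \forall q \near p, H q (S p - h) < 0.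
  by apply: (@cont_H p (S p - h) [set y | y < 0]); exact: open_nbhs_nbhs.
have nr : \forall q \near p, 0 < H q (S p + h).
  by apply: (@cont_H p (S p + h) [set y | 0 < y]); exact: open_nbhs_nbhs.
have nW : \forall q \near p, W q by exact: open_nbhs_nbhs.
near=> q.
have Wq : W q by near: q.
have Hql : H q (S p - h) < 0 by near: q.
have Hqr : 0 < H q (S p + h) by near: q.
have [_ HSq] := S_root Wq; have Sqe := S_e Wq; have Nq := WN Wq.
have lo : S p - h < S q.
  rewrite ltNge; apply/negP; rewrite le_eqVlt => /orP[/eqP Ex|lt].
    by move: Hql; rewrite -Ex HSq ltxx.
  by have := implicit_mono Nq Sqe le lt; rewrite HSq; move: Hql; lra.
have hi : S q < S p + h.
  rewrite ltNge; apply/negP; rewrite le_eqVlt => /orP[/eqP Ex|lt].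
    by move: Hqr; rewrite Ex HSq ltxx.
  by have := implicit_mono Nq ri Sqe lt; rewrite HSq; move: Hqr; lra.
apply: lt_le_trans re; rewrite ltr_norml; lra.
Unshelve. all: by end_near. Qed.

Let diff_S p : W p -> differentiable S p /\
  forall v, 'D_v S p = - l (S p) v / Hs p (S p).
Proof.
move=> Wp; have Np := WN Wp; have [Sa HS] := S_root Wp; have Se := S_e Wp.
have HsSp := Hs_gt0 Np Se.
(* A mean value point of [H q] between [S p] and [S q]. *)
pose xi q := xget (S p) [set x | [/\ `|x - a| < e, `|x - S p| <= `|S q - S p| &
  H q (S q) - H q (S p) = Hs q x * (S q - S p)]].
have xiP q : W q -> [/\ `|xi q - a| < e, `|xi q - S p| <= `|S q - S p| &
  H q (S q) - H q (S p) = Hs q (xi q) * (S q - S p)].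
  move=> Wq; have [x Px] := implicit_mvt (WN Wq) Se (S_e Wq).
  by rewrite /xi; case: xgetP => [y _ //|/(_ x)].
pose lf v := - l (S p) v / Hs p (S p).
have lin_l : linear lf.
  move=> k u w; rewrite /lf linearP /= /GRing.scale /=.
  by move: (l (S p) u) (l (S p) w) => x y; ring.
pose lL : {linear E -> R} := HB.pack lf (GRing.isLinear.Build _ _ _ _ _ lin_l).
have cL : continuous lL.
  suff h : continuous lf by exact: h.
  by move=> v; apply: cvgM; [apply: cvgN; exact: cl|exact: cvg_cst].
pose kappa q := Hs p (S p) / Hs q (xi q).
have nW : \forall q \near p, W q by exact: open_nbhs_nbhs.
have cxi : xi @ p --> S p.
  apply/cvgrPdist_lt => eps eps0.
  have nS : \forall q \near p, `|S p - S q| < eps.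
    by move/cvgrPdist_lt: (S_cont Wp); exact.
  near=> q; have Wq : W q by near: q.
  have [_ le _] := xiP q Wq.
  rewrite distrC; apply: le_lt_trans le _; rewrite distrC; near: q; exact: nS.
have ck : kappa @ p --> (1 : R).
  have Ex : 1 = Hs p (S p) / Hs p (S p) by rewrite divff // gt_eqF.
  have Hp0 : Hs p (S p) != 0 by rewrite gt_eqF.
  have cpair : (fun q => (q, xi q)) @ p --> (p, S p).
    have ci : id @ p --> p by exact: cvg_id. have := cvg_pair ci cxi. exact.
  have cH : (fun q => Hs q (xi q)) @ p --> Hs p (S p).
    exact: cvg_comp cpair (cHs Np Se).
  by rewrite Ex; apply: cvgM; [exact: cvg_cst|exact: cvgV Hp0 cH].
apply: (differentiable_ratio (l := lL) cL ck).
near=> q; have Wq : W q by near: q.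
have [xa _ Ex] := xiP q Wq; have [_ HSq] := S_root Wq.
have Hq := Hs_gt0 (WN Wq) xa.
have HqS : H q (S p) = l (S p) (q - p) by rewrite -HB HS subr0.
have Hq0 : Hs q (xi q) != 0 by rewrite gt_eqF.
have Hp0 : Hs p (S p) != 0 by rewrite gt_eqF.
move: Ex; rewrite HSq sub0r HqS => Ex.
have -> : S q - S p = - l (S p) (q - p) / Hs q (xi q) by rewrite Ex mulrC mulKf.
rewrite /kappa /= /lf.
move: (l (S p) (q - p)) (Hs q (xi q)) (Hs p (S p)) Hq0 Hp0 => x y z y0 z0.
by field; rewrite y0 z0.
Unshelve. all: by end_near. Qed.

(** [H] is increasing in the second variable, so its sign at [a - d] and [a + d],
   which persists near [p0], isolates a root. The mean value theorem in the second
   variable and the affine dependence [HB] on the point give the exact formula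
   [T q - T p = - l (T p) (q - p) / Hs q x] for some [x] between [T p] and [T q];
   continuity of [T] and [Hs] then yields differentiability. *)
Lemma implicit_function : exists r V T,
  [/\ 0 < r <= e, open V, V p0, V `<=` N &
  [/\ forall p, V p -> `|T p - a| < r /\ H p (T p) = 0,
      forall p s, V p -> `|s - a| < r -> H p s = 0 -> s = T p,
      forall p, V p -> {for p, continuous T} &
      forall p, V p -> differentiable T p /\
        forall v, 'D_v T p = - l (T p) v / Hs p (T p)]].
Proof.
exists d, W, S; split; [by rewrite d0 ltW|exact: oW|exact: Wp0|exact: WN|].
by split; [exact: S_root|exact: S_uniq|exact: S_cont|exact: diff_S].
Qed.

End ImplicitFunction.

(** * The parameter of the tangent line through a point *)

Lemma is_derive_mul_cst {R : realType} {E : normedModType R} (f : E -> R) x v df (c : R) :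
  is_derive x v f df -> is_derive x v (fun y => c * f y) (c * df).
Proof. by move=> h; have := is_deriveZ c h. Qed.

(** Vanishes exactly when [p] lies on the tangent line of [g] at [s], if [g] is regular
   there. *)
Definition incid {R : realType} (g : R -> R * R) (p : R * R) (s : R) : R :=
  det (p - g s) ('D_1 g s).
(** The derivative of [incid g p] at [s]: the other term of the product rule is the
   determinant of the velocity with itself. *)
Definition dincid {R : realType} (g : R -> R * R) (p : R * R) (s : R) : R :=
  det (p - g s) ('D_1 ('D_1 g) s).

Section TangentParameter.
Context {R : realType}.
Variables (g : R -> R * R) (I : set R).
Hypotheses (oI : open I) (sg : smooth_on I g).
Implicit Types (p q v : R * R) (s : R).

Lemma smooth_velocity : smooth_on I ('D_1 g). Proof. exact: smooth_derive. Qed.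
Lemma smooth_acceleration : smooth_on I ('D_1 ('D_1 g)). Proof. exact: smooth_derive smooth_velocity. Qed.

Lemma is_derive_incid p s : I s -> is_derive s 1 (incid g p) (dincid g p s).
Proof.
move=> Is.
have dg := smooth_differentiable sg Is; have dg1 := smooth_differentiable smooth_velocity Is.
have d0 : differentiable (fun s => p - g s) s.
  by apply: differentiableB => //; exact: differentiable_cst.
apply: DeriveDef; first by apply: diff_derivable; exact: differentiable_det.
rewrite /incid derive_det // (@deriveB _ _ _ (cst p) g); last 2 first.
  exact: derivable_cst.
  by apply: diff_derivable.
rewrite derive_cst sub0r /dincid; move: ('D_1 g s) ('D_1 ('D_1 g) s) => u w.
by rewrite /det /=; ring.
Qed.

(** The equation of the tangent line is affine in the point, with a linear part that
   depends on [s] only: the hypothesis [HB] of the implicit function theorem. *)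
Lemma incidB p q s : incid g q s - incid g p s = det (q - p) ('D_1 g s).
Proof. by rewrite /incid; move: ('D_1 g s) => u; rewrite /det /=; ring. Qed.

Lemma cont_dincid p s : I s ->
  {for (p, s), continuous (fun z : R * R * R => dincid g z.1 z.2)}.
Proof.
move=> Is; pose V : set (R * R * R) := [set z | I z.2].
have oV : open V by apply: open_comp => // z _; exact: cvg_snd.
have VI (z : R * R * R) : V z -> I z.2 by [].
have s2 : is_Ck 0 V (fun z : R * R * R => z.2) by ck.
have g0 := Ck_curve oI oV VI (sg 0%N) s2.
have g2 := Ck_curve oI oV VI (smooth_acceleration 0%N) s2.
suff h : is_Ck 0 V (fun z : R * R * R => dincid g z.1 z.2) by exact: h.
by rewrite /dincid; ck.
Qed.

(** [S] selects, among the parameters at distance less than [d] from [a], the one whose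
   tangent line passes through the point. The last clause is implicit differentiation
   of [incid g p (S p) = 0]. *)
Definition tangent_param (a d : R) (W : set (R * R)) (S : R * R -> R) : Prop :=
  [/\ open W, smooth_on W S,
      forall p, W p -> [/\ `|S p - a| < d, I (S p), incid g p (S p) = 0 &
                          dincid g p (S p) != 0],
      forall p s, W p -> `|s - a| < d -> incid g p s = 0 -> s = S p &
      forall p v, W p -> 'D_v S p = - det v ('D_1 g (S p)) / dincid g p (S p)].

(** The equation is multiplied by the constant [dincid g p0 a], which makes its
   derivative in [s] positive at [(p0, a)]. Smoothness is a bootstrap: the gradient of
   [S] is an explicit expression in [S], so it is as smooth as [S] itself. *)
Lemma exists_tangent_param (a : R) (p0 : R * R) :
  I a -> incid g p0 a = 0 -> dincid g p0 a != 0 ->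
  exists d W S,
  [/\ 0 < d, W p0, forall s, `|s - a| < d -> I s & tangent_param a d W S].
Proof.
move=> Ia H0; have [c Ec] : exists c, c = dincid g p0 a by exists (dincid g p0 a).
rewrite -Ec => c0.
pose H p s := c * incid g p s.
pose Hs p s := c * dincid g p s.
have cHs p s : I s -> {for (p, s), continuous (fun z : R * R * R => Hs z.1 z.2)}.
  by move=> Is; apply: continuousM; [exact: cst_continuous|exact: cont_dincid].
have H00 : 0 < Hs p0 a by rewrite /Hs -Ec -expr2 exprn_even_gt0.
have n1 : \forall z \near (p0, a), I z.2 /\ 0 < Hs z.1 z.2.
  apply: filterI.
    by apply: (@cvg_snd _ _ (nbhs p0) (nbhs a)); exact: open_nbhs_nbhs.
  by apply: (cHs p0 a Ia [set y | 0 < y]); exact: open_nbhs_nbhs.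
have [[N A] [/= Np0 Aa] NA] := n1.
have /nbhs_ballP[e /= e0 eA] := Aa.
have NP p s : N p -> `|s - a| < e -> I s /\ 0 < Hs p s.
  move=> Np sa; apply: (NA (p, s)); split; first exact: Np.
  by apply: eA; rewrite /ball /= distrC.
pose lf s v := c * det v ('D_1 g s).
have lin_l s : linear (lf s).
  by move=> k u w; rewrite /lf; move: ('D_1 g s) => x; rewrite /det /= /GRing.scale /=; ring.
pose l s : {linear (R * R)%type -> R} := HB.pack (lf s) (GRing.isLinear.Build _ _ _ _ _ (lin_l s)).
have cl s : continuous (l s).
  move=> v; suff h : is_Ck 0 setT (lf s) by exact: h.
  by rewrite /lf; have oT := @openT (R * R)%type; ck.
have HB p q s : H q s - H p s = l s (q - p) by rewrite /H -mulrBr incidB.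
have H0' : H p0 a = 0 by rewrite /H H0 mulr0.
have dH p s : N p -> `|s - a| < e -> is_derive s 1 (H p) (Hs p s).
  move=> Np sa; have [Is _] := NP _ _ Np sa.
  exact: is_derive_mul_cst (is_derive_incid p Is).
have Hpos p s : N p -> `|s - a| < e -> 0 < Hs p s by move=> Np /(NP _ _ Np) [].
have cHs' p s : N p -> `|s - a| < e ->
    {for (p, s), continuous (fun z : R * R * R => Hs z.1 z.2)}.
  by move=> Np /(NP _ _ Np) [Is _]; exact: cHs.
have [d [W [S [/andP[d0 de] oW Wp0 WN [S1 S2 S3 S4]]]]] :=
  implicit_function Np0 e0 H0' dH Hpos cHs' cl HB.
have Se p : W p -> `|S p - a| < e by move=> /S1 [h _]; exact: lt_le_trans de.
have WI p : W p -> I (S p) by move=> Wp; have [] := NP _ _ (WN _ Wp) (Se _ Wp).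
have dn0 p : W p -> dincid g p (S p) != 0.
  move=> Wp; have := Hpos _ _ (WN _ Wp) (Se _ Wp).
  by apply: contraTN => /eqP h; rewrite /Hs h mulr0 ltxx.
have DS p v : W p -> 'D_v S p = - det v ('D_1 g (S p)) / dincid g p (S p).
  move=> Wp; have [_ ->] := S4 _ Wp; have := dn0 _ Wp.
  rewrite /= /lf /Hs; move: (det _ _) (dincid _ _ _) => x y y0.
  by field; rewrite y0.
exists d, W, S; split; [exact: d0|exact: Wp0| |split; [exact: oW| | | |exact: DS]].
- move=> s sa; have [] := NP p0 s (nbhs_singleton Np0) => //.
  exact: lt_le_trans de.
- elim=> [|k IH]; first exact: S3.
  split=> [p Wp|v]; first by have [] := S4 _ Wp.
  have k0 := Ck_curve oI oW WI (sg k) IH.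
  have k1 := Ck_curve oI oW WI (smooth_velocity k) IH.
  have k2 := Ck_curve oI oW WI (smooth_acceleration k) IH.
  have h : is_Ck k W (fun p => - det v ('D_1 g (S p)) / dincid g p (S p)).
    by move: dn0; rewrite /dincid => dn0; ck.
  by apply: Ck_ext h => // p Wp; rewrite DS.
- move=> p Wp; have [Sa HS] := S1 _ Wp; split; [exact: Sa|exact: WI| |exact: dn0].
  by apply: (mulfI c0); rewrite mulr0; exact: HS.
- by move=> p s Wp sa h; apply: (S2 p s Wp sa); rewrite /H h; exact: mulr0.
Qed.

End TangentParameter.

(** * Connections in a radial frame *)

Section Frame.
Context {R : realType}.
Implicit Types (p q v w z : R * R) (U V : set (R * R)) (X Y Z : R * R -> R * R).
Variables (W : set (R * R)) (al be : R * R -> R * R) (lam rho : R * R -> R).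

Definition coord1 p v := det v (be p) / det (al p) (be p).
Definition coord2 p v := det (al p) v / det (al p) (be p).

(** The model is [al p = p - L (S p)] and [be p = p - K (T p)]: a displacement [z] of [p]
   changes [al p] by [z] minus the displacement of the contact point, which is along
   [al p] and vanishes when [z] is itself along [al p]; similarly for [be]. *)
Definition radial_frame :=
  [/\ open W, smooth_on W al /\ smooth_on W be,
      forall p, W p -> det (al p) (be p) != 0,
      forall p v, W p -> 'D_v al p = v - (lam p * coord2 p v) *: al p &
      forall p v, W p -> 'D_v be p = v - (rho p * coord1 p v) *: be p].

(** The symmetric tensor [Gamma] with [Gamma(al, al) = al], [Gamma(be, be) = be] and
   [Gamma(al, be) = - al - be], which turns out to be the difference between the
   canonical connection and the flat derivative of the plane. *)
Definition christoffel p v w : R * R :=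
  (coord1 p v * coord1 p w - coord1 p v * coord2 p w - coord2 p v * coord1 p w) *: al p +
  (coord2 p v * coord2 p w - coord1 p v * coord2 p w - coord2 p v * coord1 p w) *: be p.

Hypothesis frame : radial_frame.
Let oW : open W. Proof. by case: frame. Qed.
Let sal : smooth_on W al. Proof. by case: frame => _ []. Qed.
Let sbe : smooth_on W be. Proof. by case: frame => _ []. Qed.
Let ab0 p : W p -> det (al p) (be p) != 0. Proof. by case: frame => _ _ + _ _; exact. Qed.
Let Dal p v : W p -> 'D_v al p = v - (lam p * coord2 p v) *: al p.
Proof. by case: frame => _ _ _ + _; exact. Qed.
Let Dbe p v : W p -> 'D_v be p = v - (rho p * coord1 p v) *: be p.
Proof. by case: frame => _ _ _ _; exact. Qed.
Let dal p : W p -> differentiable al p. Proof. exact: smooth_differentiable. Qed.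
Let dbe p : W p -> differentiable be p. Proof. exact: smooth_differentiable. Qed.

Lemma coord_decomp p v : W p -> v = coord1 p v *: al p + coord2 p v *: be p.
Proof.
move=> /ab0; rewrite /coord1 /coord2 /det => h.
by apply: pair_eq; rewrite /= /GRing.scale /=; field.
Qed.

Lemma coord1_comb p c d : W p -> coord1 p (c *: al p + d *: be p) = c.
Proof. by move=> /ab0; rewrite /coord1 /det /= /GRing.scale /= => h; field. Qed.

Lemma coord2_comb p c d : W p -> coord2 p (c *: al p + d *: be p) = d.
Proof. by move=> /ab0; rewrite /coord2 /det /= /GRing.scale /= => h; field. Qed.

Lemma smooth_coord1 V Y : open V -> V `<=` W -> smooth_on V Y ->
  smooth_on V (fun p => coord1 p (Y p)).
Proof.
move=> oV VW sY k.
have h1 := Ck_sub VW (sal k); have h2 := Ck_sub VW (sbe k); have h3 := sY k.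
have h4 x : V x -> det (al x) (be x) != 0 by move=> /VW /ab0.
by rewrite /coord1; ck.
Qed.
Lemma smooth_coord2 V Y : open V -> V `<=` W -> smooth_on V Y ->
  smooth_on V (fun p => coord2 p (Y p)).
Proof.
move=> oV VW sY k.
have h1 := Ck_sub VW (sal k); have h2 := Ck_sub VW (sbe k); have h3 := sY k.
have h4 x : V x -> det (al x) (be x) != 0 by move=> /VW /ab0.
by rewrite /coord2; ck.
Qed.

(** The coordinates of a constant vector vary because the frame does: differentiate
   [v = coord1 v *: al + coord2 v *: be]. *)
Lemma derive_coord1 p v z : W p -> 'D_z (fun q => coord1 q v) p =
  - coord1 p z * (coord1 p v + coord2 p v) + lam p * coord2 p z * coord1 p v.
Proof.
move=> Wp; have [[da db] d0] := (dal Wp, dbe Wp, ab0 Wp).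
rewrite (@derive_div _ _ (fun q => det v (be q)) (fun q => det (al q) (be q))) //; last 2 first.
- by apply: differentiable_det => //; exact: differentiable_cst.
- exact: differentiable_det.
rewrite (@derive_det _ _ (cst v) be) //.
rewrite derive_det // derive_cst Dal // Dbe // /coord1 /coord2.
by move: d0; rewrite /det /= /GRing.scale /= => d0; field.
Qed.

Lemma derive_coord2 p v z : W p -> 'D_z (fun q => coord2 q v) p =
  - coord2 p z * (coord1 p v + coord2 p v) + rho p * coord1 p z * coord2 p v.
Proof.
move=> Wp; have [[da db] d0] := (dal Wp, dbe Wp, ab0 Wp).
rewrite (@derive_div _ _ (fun q => det (al q) v) (fun q => det (al q) (be q))) //; last 2 first.
- by apply: differentiable_det => //; exact: differentiable_cst.
- exact: differentiable_det.
rewrite (@derive_det _ _ al (cst v)) //.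
rewrite derive_det // derive_cst Dal // Dbe // /coord1 /coord2.
by move: d0; rewrite /det /= /GRing.scale /= => d0; field.
Qed.

Lemma christoffelC p v w : christoffel p v w = christoffel p w v.
Proof. by rewrite /christoffel; congr (_ *: _ + _ *: _); ring. Qed.

Lemma christoffelP p (c : R) v v' w :
  christoffel p (c *: v + v') w = c *: christoffel p v w + christoffel p v' w.
Proof.
rewrite /christoffel /coord1 /coord2 /det.
by apply: pair_eq; rewrite /= /GRing.scale /=; ring.
Qed.

Lemma christoffelDl p (c d : R) v w z :
  christoffel p (c *: v + d *: w) z = c *: christoffel p v z + d *: christoffel p w z.
Proof.
rewrite /christoffel /coord1 /coord2 /det.
by apply: pair_eq; rewrite /= /GRing.scale /=; ring.
Qed.

Lemma christoffelDr p (c d : R) v w z :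
  christoffel p z (c *: v + d *: w) = c *: christoffel p z v + d *: christoffel p z w.
Proof. by rewrite christoffelC christoffelDl !(christoffelC p z). Qed.

Lemma coord1_al p : W p -> coord1 p (al p) = 1.
Proof. by move=> Wp; rewrite /coord1 divff // ab0. Qed.
Lemma coord2_al p : coord2 p (al p) = 0.
Proof. by rewrite /coord2 detvv mul0r. Qed.
Lemma coord1_be p : coord1 p (be p) = 0.
Proof. by rewrite /coord1 detvv mul0r. Qed.
Lemma coord2_be p : W p -> coord2 p (be p) = 1.
Proof. by move=> Wp; rewrite /coord2 divff // ab0. Qed.

Lemma christoffel_al p v : W p ->
  christoffel p (al p) v = (coord1 p v - coord2 p v) *: al p - coord2 p v *: be p.
Proof.
move=> Wp; rewrite /christoffel coord1_al // coord2_al.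
move: (coord1 p v) (coord2 p v) (al p) (be p) => x y a b.
by apply: pair_eq; rewrite /= /GRing.scale /=; ring.
Qed.

Lemma christoffel_be p v : W p ->
  christoffel p (be p) v = (coord2 p v - coord1 p v) *: be p - coord1 p v *: al p.
Proof.
move=> Wp; rewrite /christoffel coord1_be coord2_be //.
move: (coord1 p v) (coord2 p v) (al p) (be p) => x y a b.
by apply: pair_eq; rewrite /= /GRing.scale /=; ring.
Qed.

Lemma parallel_al p v : W p -> det v (al p) = 0 -> v = coord1 p v *: al p.
Proof.
move=> Wp v0; rewrite {1}(coord_decomp v Wp).
suff -> : coord2 p v = 0 by rewrite scale0r addr0.
rewrite /coord2 -[det _ v]opprK; suff -> : - det (al p) v = det v (al p) by rewrite v0 oppr0 mul0r.
by rewrite /det; ring.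
Qed.

Lemma parallel_be p v : W p -> det v (be p) = 0 -> v = coord2 p v *: be p.
Proof.
by move=> Wp v0; rewrite {1}(coord_decomp v Wp) /coord1 v0 mul0r scale0r add0r.
Qed.

Lemma derive_comb (f : R * R -> R * R) p c d v w : differentiable f p ->
  'D_(c *: v + d *: w) f p = c *: 'D_v f p + d *: 'D_w f p.
Proof. by move=> df; rewrite !deriveE // linearD !linearZ. Qed.

Lemma christoffel0l p v : christoffel p 0 v = 0.
Proof. by have := christoffelDl p 0 0 0 0 v; rewrite !scale0r addr0. Qed.

Let dcoord1 p v : W p -> differentiable (fun q => coord1 q v) p.
Proof.
move=> Wp; have s : smooth_on W (fun q => coord1 q v); last exact: smooth_differentiable s Wp.
by apply: (smooth_coord1 (Y := fun=> v)) => // k; exact: Ck_cst.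
Qed.
Let dcoord2 p v : W p -> differentiable (fun q => coord2 q v) p.
Proof.
move=> Wp; have s : smooth_on W (fun q => coord2 q v); last exact: smooth_differentiable s Wp.
by apply: (smooth_coord2 (Y := fun=> v)) => // k; exact: Ck_cst.
Qed.

Let derive_quad (f g h k : R * R -> R) p v :
  differentiable f p -> differentiable g p -> differentiable h p -> differentiable k p ->
  differentiable (fun q => f q * g q - f q * k q - h q * g q) p /\
  'D_v (fun q => f q * g q - f q * k q - h q * g q) p =
  'D_v f p * g p + f p * 'D_v g p - ('D_v f p * k p + f p * 'D_v k p)
  - ('D_v h p * g p + h p * 'D_v g p).
Proof.
move=> df dg dh dk.
have fg := differentiableM df dg; have fk := differentiableM df dk.
have hg := differentiableM dh dg.
split; first exact: differentiableB (differentiableB fg fk) hg.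
have D := fun f' => @diff_derivable _ _ _ f' p v.
have E1 := deriveB (D _ _ (differentiableB fg fk)) (D _ _ hg).
rewrite [LHS]E1 (deriveB (D _ _ fg) (D _ _ fk)).
rewrite (deriveM (D _ _ df) (D _ _ dg)) (deriveM (D _ _ df) (D _ _ dk)) (deriveM (D _ _ dh) (D _ _ dg)).
move: ('D_v f p) ('D_v g p) ('D_v h p) ('D_v k p) => f' g' h' k'.
by rewrite /GRing.scale /=; move: (f p) (g p) (h p) (k p) => x y z t; ring.
Qed.

Lemma derive_christoffel p v w z : W p -> 'D_v (fun q => christoffel q w z) p =
  ('D_v (fun q => coord1 q w) p * coord1 p z + coord1 p w * 'D_v (fun q => coord1 q z) p
   - ('D_v (fun q => coord1 q w) p * coord2 p z + coord1 p w * 'D_v (fun q => coord2 q z) p)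
   - ('D_v (fun q => coord2 q w) p * coord1 p z + coord2 p w * 'D_v (fun q => coord1 q z) p)) *: al p
  + (coord1 p w * coord1 p z - coord1 p w * coord2 p z - coord2 p w * coord1 p z) *: 'D_v al p
  + (('D_v (fun q => coord2 q w) p * coord2 p z + coord2 p w * 'D_v (fun q => coord2 q z) p
   - ('D_v (fun q => coord2 q w) p * coord1 p z + coord2 p w * 'D_v (fun q => coord1 q z) p)
   - ('D_v (fun q => coord1 q w) p * coord2 p z + coord1 p w * 'D_v (fun q => coord2 q z) p)) *: be p
  + (coord2 p w * coord2 p z - coord1 p w * coord2 p z - coord2 p w * coord1 p z) *: 'D_v be p).
Proof.
move=> Wp; have xw := dcoord1 w Wp; have yw := dcoord2 w Wp.
have xz := dcoord1 z Wp; have yz := dcoord2 z Wp.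
have [dA DA] := derive_quad v xw xz yw yz.
have [dB DB] := derive_quad v yw yz xw xz.
have EB : (fun q => coord2 q w * coord2 q z - coord1 q w * coord2 q z - coord2 q w * coord1 q z) =
    (fun q => coord2 q w * coord2 q z - coord2 q w * coord1 q z - coord1 q w * coord2 q z).
  by apply/funext => q; rewrite addrAC.
have dB' := dB; rewrite -EB in dB'; rewrite -EB in DB.
have D := fun f' => @diff_derivable _ _ _ f' p v.
have E1 := deriveD (D _ _ (differentiable_scale dA (dal Wp))) (D _ _ (differentiable_scale dB' (dbe Wp))).
by rewrite [LHS]E1 (derive_scale v dA (dal Wp)) (derive_scale v dB' (dbe Wp)) DA DB.
Qed.

Section Unique.
Variables (U : set (R * R)) (F G : set (set (R * R)))
  (nabla : (R * R -> R * R) -> (R * R -> R * R) -> R * R -> R * R) (V : set (R * R)).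
Hypotheses (canon : canonical_connection U omega0 F G nabla)
  (oV : open V) (VU : V `<=` U) (VW : V `<=` W)
  (tF : forall p v, V p -> (tangent F p v <-> det v (al p) = 0))
  (tG : forall p v, V p -> (tangent G p v <-> det v (be p) = 0)).

Let salV : smooth_on V al. Proof. by move=> k; exact: Ck_sub (sal k). Qed.
Let sbeV : smooth_on V be. Proof. by move=> k; exact: Ck_sub (sbe k). Qed.

(** The covariant derivative of [be] along [al] is a multiple of [be] and that of [al]
   along [be] a multiple of [al]; the torsion condition says that their difference is
   the Lie bracket, whose two coordinates thus determine both. Parallelism of the area
   form then gives the two remaining derivatives. *)
Lemma nabla_frame p : V p ->
  [/\ nabla al al p = 2 *: al p, nabla be be p = 2 *: be p,
      nabla be al p = - (1 + lam p) *: al p & nabla al be p = - (1 + rho p) *: be p].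
Proof.
move=> Vp; have Wp := VW Vp; have d0 := ab0 Wp.
have [_ can] := canon; have [m1 m2 m3 m4] := can V oV VU.
have secal : section V F al.
  by split=> // q Vq; apply/(tF _ Vq); exact: detvv.
have secbe : section V G be.
  by split=> // q Vq; apply/(tG _ Vq); exact: detvv.
have [_ /(_ p Vp) /(tF _ Vp) taa] := m2 _ _ salV secal.
have [_ /(_ p Vp) /(tF _ Vp) tba] := m2 _ _ sbeV secal.
have [_ /(_ p Vp) /(tG _ Vp) tab] := m3 _ _ salV secbe.
have [_ /(_ p Vp) /(tG _ Vp) tbb] := m3 _ _ sbeV secbe.
have := m4 _ _ secal secbe p Vp.
have := m1 _ _ _ salV salV sbeV p Vp.
have := m1 _ _ _ sbeV salV sbeV p Vp.
rewrite /lie_bracket -![(fun q => omega0 q (al q) (be q))]/(fun q => det (al q) (be q)).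
rewrite !derive_det; [|exact: dal|exact: dbe|exact: dal|exact: dbe].
rewrite !Dal // !Dbe // !coord1_be !coord2_al !coord1_al // !coord2_be //.
rewrite (parallel_al Wp taa) (parallel_al Wp tba).
rewrite (parallel_be Wp tab) (parallel_be Wp tbb).
move: (coord1 p _) (coord1 p _) (coord2 p _) (coord2 p _) => caa cba cab cbb.
rewrite !mulr0 !mulr1 !scale0r !subr0.
rewrite /omega0.
move: (al p) (be p) (lam p) (rho p) d0 => [a1 a2] [b1 b2] l r.
rewrite /det /= /GRing.scale /= => d0 E1 E2 E3.
have E31 := congr1 fst E3; have E32 := congr1 snd E3; move: E31 E32 => /=.
rewrite /GRing.scale /= => E31 E32.
(* The torsion equation [E31], [E32], paired with [be] and then with [al]. *)
have hcba : cba = - (1 + l).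
  have : (cba + (1 + l)) * (a1 * b2 - a2 * b1) = 0.
    have -> : (cba + (1 + l)) * (a1 * b2 - a2 * b1) =
      - b2 * (cab * b1 - cba * a1 - (a1 - r * b1 - (b1 - l * a1)))
      + b1 * (cab * b2 - cba * a2 - (a2 - r * b2 - (b2 - l * a2))) by ring.
    by rewrite E31 E32 !subrr !mulr0 addr0.
  by move/eqP; rewrite mulf_eq0 (negbTE d0) orbF addr_eq0 => /eqP.
have hcab : cab = - (1 + r).
  have : (cab + (1 + r)) * (a1 * b2 - a2 * b1) = 0.
    have -> : (cab + (1 + r)) * (a1 * b2 - a2 * b1) =
      - a2 * (cab * b1 - cba * a1 - (a1 - r * b1 - (b1 - l * a1)))
      + a1 * (cab * b2 - cba * a2 - (a2 - r * b2 - (b2 - l * a2))) by ring.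
    by rewrite E31 E32 !subrr !mulr0 addr0.
  by move/eqP; rewrite mulf_eq0 (negbTE d0) orbF addr_eq0 => /eqP.
have hcaa : caa = 2.
  apply: (mulIf d0); rewrite hcab in E2.
  transitivity (caa * a1 * b2 - caa * a2 * b1); first by ring.
  move/eqP: E2; rewrite eq_sym -subr_eq0 => /eqP E2.
  by apply/eqP; rewrite -subr_eq0; apply/eqP; rewrite -E2; ring.
have hcbb : cbb = 2.
  apply: (mulIf d0); rewrite hcba in E1.
  transitivity (a1 * (cbb * b2) - a2 * (cbb * b1)); first by ring.
  move/eqP: E1; rewrite eq_sym -subr_eq0 => /eqP E1.
  by apply/eqP; rewrite -subr_eq0; apply/eqP; rewrite -E1; ring.
by rewrite hcaa hcbb hcba hcab.
Qed.

Lemma nabla_al_be p : V p ->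
  [/\ nabla al al p = 'D_(al p) al p + christoffel p (al p) (al p),
      nabla al be p = 'D_(al p) be p + christoffel p (al p) (be p),
      nabla be al p = 'D_(be p) al p + christoffel p (be p) (al p) &
      nabla be be p = 'D_(be p) be p + christoffel p (be p) (be p)].
Proof.
move=> Vp; have Wp := VW Vp; have [-> -> -> ->] := nabla_frame Vp.
rewrite !christoffel_al // !christoffel_be // !Dal // !Dbe // !coord1_be !coord2_al !coord1_al // !coord2_be //.
move: (al p) (be p) (lam p) (rho p) => x y l r.
by split; apply: pair_eq; rewrite /= /GRing.scale /=; ring.
Qed.

Let oVn p : V p -> nbhs p V. Proof. by move=> Vp; exact: open_nbhs_nbhs. Qed.

(** Both sides are additive in the field that is differentiated and obey the same
   Leibniz rule, so it suffices to compare them on the frame. *)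
Lemma nabla_on_frame_field Z : smooth_on V Z ->
  (forall p, V p -> nabla Z al p = 'D_(Z p) al p + christoffel p (Z p) (al p)) ->
  (forall p, V p -> nabla Z be p = 'D_(Z p) be p + christoffel p (Z p) (be p)) ->
  forall Y, smooth_on V Y -> forall p, V p ->
  nabla Z Y p = 'D_(Z p) Y p + christoffel p (Z p) (Y p).
Proof.
move=> sZ Za Zb Y sY p Vp; have Wp := VW Vp.
have [_ c2 _ c4 c5] := canon.1 V oV VU.
pose f q := coord1 q (Y q); pose g q := coord2 q (Y q).
have sf : smooth_on V f by exact: smooth_coord1.
have sg : smooth_on V g by exact: smooth_coord2.
have sfa : smooth_on V (fun q => f q *: al q).
  by move=> k; exact: Ck_scale oV (sf k) (salV k).
have sgb : smooth_on V (fun q => g q *: be q).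
  by move=> k; exact: Ck_scale oV (sg k) (sbeV k).
have EY q : V q -> Y q = f q *: al q + g q *: be q by move=> /VW; exact: coord_decomp.
have df := smooth_differentiable sf Vp; have dg := smooth_differentiable sg Vp.
rewrite (c2 Z Z Y (fun q => f q *: al q + g q *: be q) sZ sY _ EY p Vp) //.
rewrite c4 // c5 // c5 // Za // Zb //.
rewrite [in RHS](EY p Vp) christoffelDr.
have -> : 'D_(Z p) Y p = 'D_(Z p) (fun q => f q *: al q + g q *: be q) p.
  by apply: near_eq_derive; apply: filterS EY _; exact: oVn.
rewrite deriveD; last 2 first.
- by apply: diff_derivable; exact: differentiable_scale df (dal Wp).
- by apply: diff_derivable; exact: differentiable_scale dg (dbe Wp).
rewrite derive_scale //; last exact: dal.
rewrite derive_scale //; last exact: dbe.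
move: (christoffel p (Z p) (al p)) (christoffel p (Z p) (be p)) ('D_(Z p) al p) ('D_(Z p) be p) => u v w z.
move: ('D_(Z p) f p) ('D_(Z p) g p) (f p) (g p) (al p) (be p) => a b c d e h.
by apply: pair_eq; rewrite /= /GRing.scale /=; ring.
Qed.

(** The remaining argument enters linearly over functions on both sides, so again the
   frame suffices. *)
Lemma canonical_unique X Y p : smooth_on V X -> smooth_on V Y -> V p ->
  nabla X Y p = 'D_(X p) Y p + christoffel p (X p) (Y p).
Proof.
move=> sX sY Vp; have Wp := VW Vp.
have [_ c2 c3 _ _] := canon.1 V oV VU.
pose f q := coord1 q (X q); pose g q := coord2 q (X q).
have sf : smooth_on V f by exact: smooth_coord1.
have sg : smooth_on V g by exact: smooth_coord2.
have sfa : smooth_on V (fun q => f q *: al q).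
  by move=> k; exact: Ck_scale oV (sf k) (salV k).
have sgb : smooth_on V (fun q => g q *: be q).
  by move=> k; exact: Ck_scale oV (sg k) (sbeV k).
have EX q : V q -> X q = f q *: al q + g q *: be q by move=> /VW; exact: coord_decomp.
have s0 : smooth_on V (fun=> 0 : R * R) by move=> k; exact: Ck_cst.
have s1 : smooth_on V (fun=> 1 : R) by move=> k; exact: Ck_cst.
(* Linearity over functions only speaks of sums [f X + X'], hence [0 = 1 * 0 + 0]. *)
have n0 : nabla (fun=> 0) Y p = 0.
  have h := c3 (fun=> 1) (fun=> 0) (fun=> 0) Y s1 s0 s0 sY p Vp.
  have h' := c2 (fun=> 0) (fun=> (1 : R) *: 0 + 0) Y Y s0 sY _ _ p Vp.
  move: h; rewrite -h' ?scale1r ?addr0 // => /eqP.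
  by rewrite -subr_eq0 opprD addNKr oppr_eq0 => /eqP.
have Na : nabla al Y p = 'D_(al p) Y p + christoffel p (al p) (Y p).
  by apply: nabla_on_frame_field => // q Vq; have [] := nabla_al_be Vq.
have Nb : nabla be Y p = 'D_(be p) Y p + christoffel p (be p) (Y p).
  by apply: nabla_on_frame_field => // q Vq; have [] := nabla_al_be Vq.
rewrite (c2 X (fun q => f q *: al q + g q *: be q) Y Y sX sY EX _ p Vp) //.
rewrite c3 //.
rewrite (c2 _ (fun q => g q *: be q + 0) Y Y sgb sY _ _ p Vp) //; last first.
  by move=> q _; rewrite addr0.
rewrite c3 // n0 Na Nb EX // derive_comb; last exact: smooth_differentiable sY Vp.
rewrite christoffelDl addr0; move: (christoffel p (al p) _) (christoffel p (be p) _) => u w.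
by rewrite !scalerDr addrACA.
Qed.

(** Constant fields commute and have no flat derivative, so only [Gamma] contributes.
   They are also smooth everywhere, hence admissible in any neighbourhood on which
   the curvature is assumed to vanish. *)
Lemma curvature_frame p v w z : V p ->
  curvature_tensor nabla (fun=> v) (fun=> w) (fun=> z) p =
  'D_v (fun q => christoffel q w z) p - 'D_w (fun q => christoffel q v z) p
  + christoffel p v (christoffel p w z) - christoffel p w (christoffel p v z).
Proof.
move=> Vp; have Wp := VW Vp.
have [c1 _ _ _ _] := canon.1 V oV VU.
have sc (u : R * R) : smooth_on V (fun=> u) by move=> k; exact: Ck_cst.
have N u u' q : V q -> nabla (fun=> u) (fun=> u') q = christoffel q u u'.
  by move=> Vq; rewrite canonical_unique // derive_cst add0r.
have NN u u' u'' : nabla (fun=> u) (nabla (fun=> u') (fun=> u'')) p =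
    'D_u (fun q => christoffel q u' u'') p + christoffel p u (christoffel p u' u'').
  rewrite canonical_unique //; last exact: c1.
  have ND : 'D_u (nabla (fun=> u') (fun=> u'')) p = 'D_u (fun q => christoffel q u' u'') p.
    by apply: near_eq_derive; apply: filterS (N u' u'') _; exact: oVn.
  by rewrite ND N.
have L : lie_bracket (fun=> v) (fun=> w) = (fun=> 0 : R * R).
  by apply/funext => q; rewrite /lie_bracket !derive_cst subr0.
rewrite /curvature_tensor !NN L canonical_unique // derive0 christoffel0l addr0 subr0.
by rewrite opprD addrACA addrA.
Qed.

(** The curvature at [p] is evaluated on the constant fields with the values [al p],
   [be p], [al p]; it equals [- (lam p + rho p + 3) *: al p]. *)
Lemma flat_relation p : V p ->
  (forall v w z, curvature_tensor nabla (fun=> v) (fun=> w) (fun=> z) p = 0) ->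
  lam p + rho p + 3 = 0.
Proof.
move=> Vp /(_ (al p) (be p) (al p)); have Wp := VW Vp; have d0 := ab0 Wp.
rewrite curvature_frame // !derive_christoffel // !derive_coord1 // !derive_coord2 // !Dal // !Dbe //.
rewrite !christoffel_al // !christoffel_be // !coord1_be !coord2_al !coord1_al // !coord2_be //.
have -> : (1 - 0) *: al p - 0 *: be p = 1 *: al p + 0 *: be p :> R * R.
  by rewrite subr0 !scale0r subr0 addr0.
have -> : (0 - 1) *: be p - 1 *: al p = (- 1) *: al p + (- 1) *: be p :> R * R.
  by rewrite sub0r scaleNr addrC scaleNr.
rewrite !coord1_comb // !coord2_comb //.
move: (al p) (be p) (lam p) (rho p) d0 => a b l r d0 E1.
have : (l + r + 3) * det a b = 0; last first.
  by move/eqP; rewrite mulf_eq0 (negbTE d0) orbF => /eqP.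
have E2 : - (l + r + 3) *: a = 0.
  by rewrite -[RHS]E1; apply: pair_eq; rewrite /= /GRing.scale /=; ring.
have -> : (l + r + 3) * det a b = - det (- (l + r + 3) *: a) b.
  by rewrite /det /= /GRing.scale /=; ring.
by rewrite E2 /det /= !mul0r subrr oppr0.
Qed.

End Unique.
End Frame.

(** * Existence of the canonical connection *)

Section Connection.
Context {R : realType}.
Implicit Types (p q v w z : R * R) (U V : set (R * R)) (X Y Z : R * R -> R * R).
Variables (W : set (R * R)) (al be : R * R -> R * R) (lam rho : R * R -> R).

Definition radial_connection X Y : R * R -> R * R :=
  fun p => 'D_(X p) Y p + christoffel al be p (X p) (Y p).

Hypothesis frame : radial_frame W al be lam rho.
Let ab0 p : W p -> det (al p) (be p) != 0. Proof. by case: frame => _ _ + _ _; exact. Qed.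
Let sal : smooth_on W al. Proof. by case: frame => _ []. Qed.
Let sbe : smooth_on W be. Proof. by case: frame => _ []. Qed.
Let dal p : W p -> differentiable al p. Proof. exact: smooth_differentiable. Qed.
Let dbe p : W p -> differentiable be p. Proof. exact: smooth_differentiable. Qed.
Let Dal p v : W p -> 'D_v al p = v - (lam p * coord2 al be p v) *: al p.
Proof. by case: frame => _ _ _ + _; exact. Qed.
Let Dbe p v : W p -> 'D_v be p = v - (rho p * coord1 al be p v) *: be p.
Proof. by case: frame => _ _ _ _; exact. Qed.

Lemma derive_partials (f : R * R -> R * R) p v : differentiable f p ->
  'D_v f p = v.1 *: 'D_(1, 0) f p + v.2 *: 'D_(0, 1) f p.
Proof.
have E : v.1 *: (1, 0) + v.2 *: (0, 1) = v :> R * R.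
  by apply: pair_eq; rewrite /= /GRing.scale /= ?mulr1 ?mulr0 ?addr0 ?add0r.
by move=> df; have := @derive_comb _ f p v.1 v.2 (1, 0) (0, 1) df; rewrite E.
Qed.

Lemma smooth_derive_field V X Y : open V -> smooth_on V X -> smooth_on V Y ->
  smooth_on V (fun p => 'D_(X p) Y p).
Proof.
move=> oV sX sY k.
have h1 := smooth_derive ((1, 0) : R * R) sY k.
have h2 := smooth_derive ((0, 1) : R * R) sY k.
have h3 := Ck_scale oV (Ck_fst oV (sX k)) h1.
have h4 := Ck_scale oV (Ck_snd oV (sX k)) h2.
have E p : V p -> (X p).1 *: 'D_(1, 0) Y p + (X p).2 *: 'D_(0, 1) Y p = 'D_(X p) Y p.
  by move=> Vp; rewrite -(derive_partials _ (smooth_differentiable sY Vp)).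
exact: Ck_ext oV E (CkD oV h3 h4).
Qed.

Lemma smooth_christoffel V X Y : open V -> V `<=` W -> smooth_on V X -> smooth_on V Y ->
  smooth_on V (fun p => christoffel al be p (X p) (Y p)).
Proof.
move=> oV VW sX sY k.
have a1 := Ck_sub VW (sal k); have b1 := Ck_sub VW (sbe k).
have xX := smooth_coord1 frame oV VW sX k; have yX := smooth_coord2 frame oV VW sX k.
have xY := smooth_coord1 frame oV VW sY k; have yY := smooth_coord2 frame oV VW sY k.
have m1 := CkM oV xX xY; have m2 := CkM oV xX yY; have m3 := CkM oV yX xY.
have m4 := CkM oV yX yY.
have A := Ck_scale oV (CkB oV (CkB oV m1 m2) m3) a1.
have B := Ck_scale oV (CkB oV (CkB oV m4 m2) m3) b1.
exact: CkD oV A B.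
Qed.

Lemma affine_radial_connection U : U `<=` W -> affine_connection U radial_connection.
Proof.
move=> UW V oV VU; have VW : V `<=` W by move=> p /VU /UW.
have nV p : V p -> nbhs p V by move=> Vp; exact: open_nbhs_nbhs.
split.
- move=> X Y sX sY k.
  exact: CkD oV (smooth_derive_field oV sX sY k) (smooth_christoffel oV VW sX sY k).
- move=> X X' Y Y' sX sY EX EY p Vp; rewrite /radial_connection.
  have ED : 'D_(X p) Y p = 'D_(X p) Y' p.
    by apply: near_eq_derive; apply: filterS EY _; exact: nV.
  by rewrite -(EX _ Vp) -(EY _ Vp) ED.
- move=> f X X' Y sf sX sX' sY p Vp; rewrite /radial_connection.
  have := @derive_comb _ Y p (f p) 1 (X p) (X' p) (smooth_differentiable sY Vp).
  rewrite !scale1r => ->; rewrite christoffelP.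
  move: (christoffel al be p (X p) (Y p)) (christoffel al be p (X' p) (Y p)) => u w.
  move: ('D_(X p) Y p) ('D_(X' p) Y p) => y y'.
  by rewrite scalerDr addrACA.
- move=> X Y Y' sX sY sY' p Vp; rewrite /radial_connection.
  have dY := diff_derivable (smooth_differentiable sY Vp).
  have dY' := diff_derivable (smooth_differentiable sY' Vp).
  rewrite (deriveD (dY (X p)) (dY' (X p))).
  have := christoffelDr al be p 1 1 (Y p) (Y' p) (X p); rewrite !scale1r => ->.
  move: (christoffel al be p (X p) (Y p)) (christoffel al be p (X p) (Y' p)) => u w.
  move: ('D_(X p) Y p) ('D_(X p) Y' p) => y y'.
  by rewrite addrACA.
- move=> f X Y sf sX sY p Vp; rewrite /radial_connection.
  rewrite (derive_scale _ (smooth_differentiable sf Vp) (smooth_differentiable sY Vp)).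
  have := christoffelDr al be p (f p) 0 (Y p) 0 (X p); rewrite !scale0r !addr0 => ->.
  move: (christoffel al be p (X p) (Y p)) ('D_(X p) f p) ('D_(X p) Y p) => u f' y.
  by rewrite scalerDr addrA.
Qed.

(** [Gamma(v, .)] has trace zero; as the flat derivative preserves the area form, this
   is why [D + Gamma] does too. *)
Lemma christoffel_trace0 p v y z : W p ->
  det (christoffel al be p v y) z + det y (christoffel al be p v z) = 0.
Proof.
move=> /ab0; rewrite /christoffel /coord1 /coord2 /det; move: (al p) (be p) => a b.
by rewrite /= /GRing.scale /= => d0; field.
Qed.

(** Sections of [F] are characterised by [det (Y q) (al q) = 0], and differentiating this
   identity shows that the flat derivative of a section leaves [F] exactly by what
   [Gamma] compensates. The torsion condition holds because [Gamma] is symmetric. *)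
Lemma canonical_radial_connection U (F G : set (set (R * R))) : U `<=` W ->
  (forall p v, U p -> (tangent F p v <-> det v (al p) = 0)) ->
  (forall p v, U p -> (tangent G p v <-> det v (be p) = 0)) ->
  canonical_connection U omega0 F G radial_connection.
Proof.
move=> UW tF tG; split=> [|V oV VU]; first exact: affine_radial_connection.
have VW : V `<=` W by move=> p /VU /UW.
have nV p : V p -> nbhs p V by move=> Vp; exact: open_nbhs_nbhs.
have [c1 _ _ _ _] := affine_radial_connection UW oV VU.
have det0 (f g : R * R -> R * R) p v : V p -> differentiable f p -> differentiable g p ->
    (forall q, V q -> det (f q) (g q) = 0) ->
    det ('D_v f p) (g p) + det (f p) ('D_v g p) = 0.
  move=> Vp df dg fg; rewrite -derive_det //.
  have -> : 'D_v (fun q => det (f q) (g q)) p = 'D_v (fun=> 0 : R) p.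
    by apply: near_eq_derive; apply: filterS fg _; exact: nV.
  exact: derive_cst.
split.
- move=> X Y Z sX sY sZ p Vp.
  rewrite -[fun q => omega0 q (Y q) (Z q)]/(fun q => det (Y q) (Z q)).
  rewrite (derive_det _ (smooth_differentiable sY Vp) (smooth_differentiable sZ Vp)).
  have := christoffel_trace0 (X p) (Y p) (Z p) (VW _ Vp).
  rewrite /radial_connection; move: (christoffel al be p (X p) (Y p)) (christoffel al be p (X p) (Z p)) => u w.
  move: ('D_(X p) Y p) ('D_(X p) Z p) => y z; rewrite /omega0 /det /= => E.
  by apply/eqP; rewrite -subr_eq0 -oppr_eq0; apply/eqP; rewrite -[RHS]E; ring.
- move=> X Y sX [sY tY]; split=> [|p Vp]; first exact: c1.
  have Wp := VW _ Vp; apply/tF; first exact: VU.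
  have Y0 q : V q -> det (Y q) (al q) = 0 by move=> Vq; apply/tF; [exact: VU|exact: tY].
  have := det0 _ _ p (X p) Vp (smooth_differentiable sY Vp) (dal Wp) Y0.
  rewrite /radial_connection Dal // (parallel_al frame Wp (Y0 _ Vp)).
  have := christoffelDr al be p (coord1 al be p (Y p)) 0 (al p) 0 (X p); rewrite !scale0r !addr0 => ->.
  rewrite (christoffelC al be p _ (al p)) (christoffel_al frame _ Wp).
  move: ('D_(X p) Y p) => d.
  have := coord_decomp frame (X p) Wp.
  move: (coord1 al be p (X p)) (coord2 al be p (X p)) (coord1 al be p (Y p)) => x y c ->.
  move: (al p) (be p) => a b.
  rewrite /det /= /GRing.scale /= => E.
  by rewrite -[RHS]E; ring.
- move=> X Y sX [sY tY]; split=> [|p Vp]; first exact: c1.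
  have Wp := VW _ Vp; apply/tG; first exact: VU.
  have Y0 q : V q -> det (Y q) (be q) = 0 by move=> Vq; apply/tG; [exact: VU|exact: tY].
  have := det0 _ _ p (X p) Vp (smooth_differentiable sY Vp) (dbe Wp) Y0.
  rewrite /radial_connection Dbe // (parallel_be frame Wp (Y0 _ Vp)).
  have := christoffelDr al be p (coord2 al be p (Y p)) 0 (be p) 0 (X p); rewrite !scale0r !addr0 => ->.
  rewrite (christoffelC al be p _ (be p)) (christoffel_be frame _ Wp).
  move: ('D_(X p) Y p) => d.
  have := coord_decomp frame (X p) Wp.
  move: (coord1 al be p (X p)) (coord2 al be p (X p)) (coord2 al be p (Y p)) => x y c ->.
  move: (al p) (be p) => a b.
  rewrite /det /= /GRing.scale /= => E.
  by rewrite -[RHS]E; ring.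
move=> X Y [sX _] [sY _] p Vp; rewrite /radial_connection /lie_bracket.
rewrite (christoffelC al be p (Y p)); move: (christoffel al be p (X p) (Y p)) ('D_(X p) Y p) ('D_(Y p) X p) => u y x.
by rewrite opprD addrACA subrr addr0.
Qed.

End Connection.

(** * The overdetermined system *)

Section Overdetermined.
Context {R : realType}.
Variables (V : set (R * R)) (al be : R * R -> R * R) (lam rho tau : R * R -> R).
Hypotheses (oV : open V)
  (flat : forall p, V p -> lam p + rho p + 3 = 0)
  (rho0 : forall p, V p -> rho p != 0)
  (lam_al : forall p, V p -> has_derive p (al p) lam (- lam p * (rho p + 2)))
  (rho_be : forall p, V p -> has_derive p (be p) rho (- rho p * (lam p + 2)))
  (rho_al : forall p, V p ->
     has_derive p (al p) rho (rho p * (1 + 2 * rho p + rho p * tau p)))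
  (tau_be : forall p, V p -> has_derive p (be p) tau (tau p - 3 / rho p)).

(** Each identity below is differentiated along one of the two fields, with [lam]
   replaced by [- rho - 3], until only finitely many values of [rho] are left. *)
Lemma overdetermined p : ~ V p.
Proof.
(* The flatness relation differentiated along [al]. *)
have F q : V q -> rho q * rho q * tau q + 3 * (rho q * rho q) + 6 * rho q + 6 = 0.
  move=> Vq.
  have := has_derive_zero oV Vq flat
    (has_deriveD (has_deriveD (lam_al Vq) (rho_al Vq)) (has_derive_cst _ _ (3 : R))).
  have -> : lam q = - (rho q + 3).
    by apply/eqP; rewrite -addr_eq0 addrA; apply/eqP; exact: flat.
  by move=> E; rewrite -[RHS]E; ring.
(* [F] differentiated along [be]; [tau] is eliminated by [F] itself. *)
have G q : V q -> (rho q + 1) * (rho q + 2) = 0.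
  move=> Vq; have Fq := F q Vq.
  have r2 := has_deriveM (rho_be Vq) (rho_be Vq).
  have := has_derive_zero oV Vq F
    (has_deriveD (has_deriveD (has_deriveD (has_deriveM r2 (tau_be Vq))
      (has_deriveM (has_derive_cst _ _ (3 : R)) r2))
      (has_deriveM (has_derive_cst _ _ (6 : R)) (rho_be Vq))) (has_derive_cst _ _ (6 : R))).
  have -> : lam q = - (rho q + 3).
    by apply/eqP; rewrite -addr_eq0 addrA; apply/eqP; exact: flat.
  move: (rho0 Vq) Fq; move: (rho q) (tau q) => r t r0 Fq.
  set d := (X in X = 0 -> _) => d0.
  have : 9 * ((r + 1) * (r + 2)) = (3 + 2 * r) * (r * r * t + 3 * (r * r) + 6 * r + 6) - d.
    by rewrite /d; field.
  rewrite Fq d0 mulr0 subrr => /eqP; rewrite mulf_eq0 => /orP[/eqP h|/eqP //].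
  by move: h; lra.
move=> Vp.
(* At a root of [G] the factor [2 * rho p + 3] is nonzero, so every derivative of [rho]
   vanishes there. *)
have Gd v dr : has_derive p v rho dr -> dr * (2 * rho p + 3) = 0.
  move=> hr.
  have := has_derive_zero oV Vp G (has_deriveM (has_deriveD hr (has_derive_cst _ _ (1 : R)))
    (has_deriveD hr (has_derive_cst _ _ (2 : R)))).
  by move=> E; rewrite -[RHS]E; ring.
have lE : lam p = - (rho p + 3).
  by apply/eqP; rewrite -addr_eq0 addrA; apply/eqP; exact: flat.
have := Gd _ _ (rho_be Vp); have := Gd _ _ (rho_al Vp).
have := F p Vp; rewrite lE.
move/eqP: (G p Vp); rewrite mulf_eq0 !addr_eq0 => /orP[/eqP ->|/eqP ->].
  by move=> h1 h2 _; move: h1 h2; lra.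
by move=> _ _; lra.
Qed.

End Overdetermined.

(** * The net of tangent lines of two curves *)

Section TwoCurves.
Context {R : realType}.
Variables (L K : R -> R * R) (I J : set R) (a b d e : R) (WL WK : set (R * R))
  (S T : R * R -> R).
Hypotheses (oI : open I) (oJ : open J) (sL : smooth_on I L) (sK : smooth_on J K)
  (tS : tangent_param L I a d WL S) (tT : tangent_param K J b e WK T).
Implicit Types (p q v w z : R * R).

Definition radial (g : R -> R * R) (P : R * R -> R) p : R * R := p - g (P p).
Let al := radial L S.
Let be := radial K T.
Let A p : R * R := 'D_1 L (S p).
Let A2 p : R * R := 'D_1 ('D_1 L) (S p).
Let B p : R * R := 'D_1 K (T p).
Let B2 p : R * R := 'D_1 ('D_1 K) (T p).
Let B3 p : R * R := 'D_1 ('D_1 ('D_1 K)) (T p).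

Definition net_domain :=
  ((WL `&` WK) `&` [set p | det (al p) (be p) != 0]) `&` [set p | det (A p) (B p) != 0].
Let W := net_domain.

(** With [A = L'] and [A2 = L''] at the contact point, [A] is [c *: al] for
   [c = det A be / det al be], and [S] has derivative [- det z A / det al A2] along [z].
   So the contact point moves by [c^2 (det al be / det al A2) *: al] times the second
   coordinate of [z], which is the [lam] of a radial frame; similarly for [rho]. *)
Definition net_lam p :=
  det (A p) (be p) * det (A p) (be p) / (det (al p) (be p) * det (al p) (A2 p)).
Definition net_rho p :=
  - (det (al p) (B p) * det (al p) (B p) / (det (al p) (be p) * det (be p) (B2 p))).
(** Read off from the derivative of [net_rho] along [al]; the only one of the three
   functions that involves the third derivative of [K]. *)
Definition net_tau p :=
  3 * (det (al p) (B2 p) * det (al p) (be p)) / (det (al p) (B p) * det (al p) (B p))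
  - det (be p) (B3 p) * det (al p) (be p) / (det (al p) (B p) * det (be p) (B2 p)).

Let WI p : W p -> I (S p).
Proof. by move=> [[[Wp _] _] _]; case: tS => _ _ h _ _; have [] := h _ Wp. Qed.
Let WJ p : W p -> J (T p).
Proof. by move=> [[[_ Wp] _] _]; case: tT => _ _ h _ _; have [] := h _ Wp. Qed.
Let d0 p : W p -> det (al p) (be p) != 0. Proof. by case=> [[]]. Qed.
Let AB0 p : W p -> det (A p) (B p) != 0. Proof. by case. Qed.
Let P0 p : W p -> det (al p) (A2 p) != 0.
Proof. by move=> [[[Wp _] _] _]; case: tS => _ _ h _ _; have [] := h _ Wp. Qed.
Let Q0 p : W p -> det (be p) (B2 p) != 0.
Proof. by move=> [[[_ Wp] _] _]; case: tT => _ _ h _ _; have [] := h _ Wp. Qed.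
Let alA p : W p -> det (al p) (A p) = 0.
Proof. by move=> [[[Wp _] _] _]; case: tS => _ _ h _ _; have [] := h _ Wp. Qed.
Let beB p : W p -> det (be p) (B p) = 0.
Proof. by move=> [[[_ Wp] _] _]; case: tT => _ _ h _ _; have [] := h _ Wp. Qed.

Lemma open_net_domain : open W.
Proof.
have oWL : open WL by case: tS.
have oWK : open WK by case: tT.
have o0 : open (WL `&` WK) by exact: openI.
have sS k : is_Ck k (WL `&` WK) S.
  by apply: (@Ck_sub _ _ _ _ WL); [exact: subIsetl|case: tS => _ h _ _ _; exact: h].
have sT k : is_Ck k (WL `&` WK) T.
  by apply: (@Ck_sub _ _ _ _ WK); [exact: subIsetr|case: tT => _ h _ _ _; exact: h].
have SI p : (WL `&` WK) p -> I (S p).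
  by move=> [Wp _]; case: tS => _ _ h _ _; have [] := h _ Wp.
have TJ p : (WL `&` WK) p -> J (T p).
  by move=> [_ Wp]; case: tT => _ _ h _ _; have [] := h _ Wp.
have c1 := Ck_curve oI o0 SI (sL 0) (sS 0%N).
have c2 := Ck_curve oJ o0 TJ (sK 0) (sT 0%N).
have c3 := Ck_curve oI o0 SI (smooth_velocity sL 0) (sS 0%N).
have c4 := Ck_curve oJ o0 TJ (smooth_velocity sK 0) (sT 0%N).
have i0 : is_Ck 0 (WL `&` WK) (fun p : R * R => p) by exact: Ck_id.
have h1 : is_Ck 0 (WL `&` WK) (fun p => det (al p) (be p)).
  exact: Ck_det o0 (CkB_pair o0 i0 c1) (CkB_pair o0 i0 c2).
have h2 := Ck_det o0 c3 c4.
have o1 := open_neq0_in o0 h1.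
apply: open_neq0_in => // p [Wp _]; exact: h2.
Qed.

Let WLd p : W p -> WL p. Proof. by move=> [[[]]]. Qed.
Let WKd p : W p -> WK p. Proof. by move=> [[[]]]. Qed.
Let sSW : smooth_on W S.
Proof. by move=> k; apply: (@Ck_sub _ _ _ _ WL); [exact: WLd|case: tS => _ h _ _ _; exact: h]. Qed.
Let sTW : smooth_on W T.
Proof. by move=> k; apply: (@Ck_sub _ _ _ _ WK); [exact: WKd|case: tT => _ h _ _ _; exact: h]. Qed.

Lemma smooth_al : smooth_on W al.
Proof.
move=> k; exact: CkB_pair open_net_domain (Ck_id k W) (Ck_curve oI open_net_domain WI (sL k) (sSW k)).
Qed.
Lemma smooth_be : smooth_on W be.
Proof.
move=> k; exact: CkB_pair open_net_domain (Ck_id k W) (Ck_curve oJ open_net_domain WJ (sK k) (sTW k)).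
Qed.

Let dS p v : W p -> has_derive p v S (- det v (A p) / det (al p) (A2 p)).
Proof.
move=> Wp; split; first exact: smooth_differentiable sSW Wp.
by case: tS => _ _ _ _ h; exact: h (WLd Wp).
Qed.
Let dT p v : W p -> has_derive p v T (- det v (B p) / det (be p) (B2 p)).
Proof.
move=> Wp; split; first exact: smooth_differentiable sTW Wp.
by case: tT => _ _ _ _ h; exact: h (WKd Wp).
Qed.

Let sL1 := smooth_velocity sL. Let sL2 := smooth_velocity sL1.
Let sK1 := smooth_velocity sK. Let sK2 := smooth_velocity sK1.

Let dB p v : W p -> has_derive p v B ((- det v (B p) / det (be p) (B2 p)) *: B2 p).
Proof. by move=> Wp; exact: has_derive_curve (dT v Wp) (smooth_differentiable sK1 (WJ Wp)). Qed.
Let dB2 p v : W p -> has_derive p v B2 ((- det v (B p) / det (be p) (B2 p)) *: B3 p).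
Proof. by move=> Wp; exact: has_derive_curve (dT v Wp) (smooth_differentiable sK2 (WJ Wp)). Qed.

Let EA p : W p -> A p = (det (A p) (be p) / det (al p) (be p)) *: al p.
Proof. by move=> Wp; exact: proportional (d0 Wp) (alA Wp). Qed.
Let EB p : W p -> B p = (det (al p) (B p) / det (al p) (be p)) *: be p.
Proof.
move=> Wp; have ba : det (be p) (al p) != 0 by rewrite detC oppr_eq0 d0.
rewrite {1}(proportional ba (beB Wp)); congr (_ *: _).
by rewrite (detC (be p)) (detC (B p)) invrN mulrNN.
Qed.

Lemma derive_al p v : W p ->
  has_derive p v al (v - (net_lam p * coord2 al be p v) *: al p).
Proof.
move=> Wp.
have := has_deriveB (has_derive_id p v) (has_derive_curve (dS v Wp) (smooth_differentiable sL (WI Wp))).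
move=> h; apply: has_derive_eq h _.
rewrite -/(A p) /net_lam /coord2 [in LHS](EA Wp) detZr scalerA.
rewrite (detC v).
move: (d0 Wp) (P0 Wp); move: (det (A p) (be p)) (det (al p) (be p)) (det (al p) v) (det (al p) (A2 p)) (al p).
by move=> x D y P u D0 P1; congr (_ - _ *: _); field; rewrite D0 P1.
Qed.

Lemma derive_be p v : W p ->
  has_derive p v be (v - (net_rho p * coord1 al be p v) *: be p).
Proof.
move=> Wp.
have := has_deriveB (has_derive_id p v) (has_derive_curve (dT v Wp) (smooth_differentiable sK (WJ Wp))).
move=> h; apply: has_derive_eq h _.
rewrite -/(B p) /net_rho /coord1 [in LHS](EB Wp) detZr scalerA.
move: (d0 Wp) (Q0 Wp); move: (det (al p) (B p)) (det (al p) (be p)) (det v (be p)) (det (be p) (B2 p)) (be p).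
by move=> x D y P u D0 P1; congr (_ - _ *: _); field; rewrite D0 P1.
Qed.

Lemma radial_frame_net : radial_frame W al be net_lam net_rho.
Proof.
split; [exact: open_net_domain|split; [exact: smooth_al|exact: smooth_be]|exact: d0| |].
  by move=> p v Wp; have [] := derive_al v Wp.
by move=> p v Wp; have [] := derive_be v Wp.
Qed.

(* Along [al] the contact point on [L] stays fixed. *)
Let al_al p : W p -> has_derive p (al p) al (al p).
Proof.
move=> Wp; apply: has_derive_eq (derive_al (al p) Wp) _.
by rewrite coord2_al mulr0 scale0r subr0.
Qed.
Let be_al p : W p -> has_derive p (al p) be (al p - net_rho p *: be p).
Proof.
move=> Wp; apply: has_derive_eq (derive_be (al p) Wp) _.
by rewrite (coord1_al radial_frame_net Wp) mulr1.
Qed.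
Let S_al p : W p -> has_derive p (al p) S 0.
Proof. by move=> Wp; apply: has_derive_eq (dS (al p) Wp) _; rewrite (alA Wp) oppr0 mul0r. Qed.
Let A_al p : W p -> has_derive p (al p) A 0.
Proof. by move=> Wp; exact: has_derive_curve0 (S_al Wp) (smooth_differentiable sL1 (WI Wp)). Qed.
Let A2_al p : W p -> has_derive p (al p) A2 0.
Proof. by move=> Wp; exact: has_derive_curve0 (S_al Wp) (smooth_differentiable sL2 (WI Wp)). Qed.
(* Along [be] the contact point on [K] stays fixed. *)
Let be_be p : W p -> has_derive p (be p) be (be p).
Proof.
move=> Wp; apply: has_derive_eq (derive_be (be p) Wp) _.
by rewrite coord1_be mulr0 scale0r subr0.
Qed.
Let al_be p : W p -> has_derive p (be p) al (be p - net_lam p *: al p).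
Proof.
move=> Wp; apply: has_derive_eq (derive_al (be p) Wp) _.
by rewrite (coord2_be radial_frame_net Wp) mulr1.
Qed.
Let T_be p : W p -> has_derive p (be p) T 0.
Proof. by move=> Wp; apply: has_derive_eq (dT (be p) Wp) _; rewrite (beB Wp) oppr0 mul0r. Qed.
Let B_be p : W p -> has_derive p (be p) B 0.
Proof. by move=> Wp; exact: has_derive_curve0 (T_be Wp) (smooth_differentiable sK1 (WJ Wp)). Qed.
Let B2_be p : W p -> has_derive p (be p) B2 0.
Proof. by move=> Wp; exact: has_derive_curve0 (T_be Wp) (smooth_differentiable sK2 (WJ Wp)). Qed.
Let B3_be p : W p -> has_derive p (be p) B3 0.
Proof. by move=> Wp; exact: has_derive_curve0 (T_be Wp) (smooth_differentiable (smooth_velocity sK2) (WJ Wp)). Qed.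

Let Ab0 p : W p -> det (A p) (be p) != 0.
Proof.
move=> Wp; apply: contra_neq (AB0 Wp) => h.
by rewrite (EA Wp) h mul0r scale0r det0l.
Qed.
Let aB0 p : W p -> det (al p) (B p) != 0.
Proof.
move=> Wp; apply: contra_neq (AB0 Wp) => h.
by rewrite (EB Wp) h mul0r scale0r det0r.
Qed.

Lemma tangent_al p v : W p -> det v ('D_1 L (S p)) = 0 <-> det v (al p) = 0.
Proof.
move=> Wp; rewrite -[det v ('D_1 L _)]/(det v (A p)) (EA Wp) detZr.
have c0 : det (A p) (be p) / det (al p) (be p) != 0.
  by rewrite mulf_neq0 ?invr_eq0 ?Ab0 ?d0.
split=> [/eqP|->]; last by rewrite mulr0.
by rewrite mulf_eq0 (negbTE c0) => /eqP.
Qed.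

Lemma tangent_be p v : W p -> det v ('D_1 K (T p)) = 0 <-> det v (be p) = 0.
Proof.
move=> Wp; rewrite -[det v ('D_1 K _)]/(det v (B p)) (EB Wp) detZr.
have c0 : det (al p) (B p) / det (al p) (be p) != 0.
  by rewrite mulf_neq0 ?invr_eq0 ?aB0 ?d0.
split=> [/eqP|->]; last by rewrite mulr0.
by rewrite mulf_eq0 (negbTE c0) => /eqP.
Qed.

Lemma net_rho_neq0 p : W p -> net_rho p != 0.
Proof.
move=> Wp; rewrite /net_rho oppr_eq0 !mulf_neq0 ?invr_eq0 ?mulf_neq0 //;
  by [exact: aB0|exact: d0|exact: Q0].
Qed.

Lemma net_lam_along_al p : W p -> has_derive p (al p) net_lam (- net_lam p * (net_rho p + 2)).
Proof.
move=> Wp.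
have f1 := has_derive_det (A_al Wp) (be_al Wp).
have f2 := has_derive_det (al_al Wp) (be_al Wp).
have f3 := has_derive_det (al_al Wp) (A2_al Wp).
have n0 : det (al p) (be p) * det (al p) (A2 p) != 0 by rewrite mulf_neq0 ?d0 ?P0.
have h := has_derive_div (has_deriveM f1 f1) (has_deriveM f2 f3) n0.
apply: (@has_derive_eq _ _ _ _ _ net_lam _ _ h).
rewrite /net_lam; move: (net_rho p) (alA Wp) (d0 Wp) (P0 Wp).
move: (al p) (be p) (A p) (A2 p) => x y u u2 r xu D0 P1.
rewrite !detBr !detZr !det0l !det0r !detvv (detC u x) xu.
move: (det u y) (det x y) (det x u2) D0 P1 => uy D P D0 P1.
by field; rewrite D0 P1.
Qed.

Lemma net_rho_along_be p : W p -> has_derive p (be p) net_rho (- net_rho p * (net_lam p + 2)).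
Proof.
move=> Wp.
have f1 := has_derive_det (al_be Wp) (B_be Wp).
have f2 := has_derive_det (al_be Wp) (be_be Wp).
have f3 := has_derive_det (be_be Wp) (B2_be Wp).
have n0 : det (al p) (be p) * det (be p) (B2 p) != 0 by rewrite mulf_neq0 ?d0 ?Q0.
have h := has_deriveN (has_derive_div (has_deriveM f1 f1) (has_deriveM f2 f3) n0).
apply: (@has_derive_eq _ _ _ _ _ net_rho _ _ h).
rewrite /net_rho; move: (net_lam p) (beB Wp) (d0 Wp) (Q0 Wp).
move: (al p) (be p) (B p) (B2 p) => x y w w2 l yw D0 Q1.
rewrite !detBl !detZl !det0r !detvv yw.
move: (det x w) (det x y) (det y w2) D0 Q1 => xw D Q D0 Q1.
by field; rewrite D0 Q1.
Qed.

Lemma net_rho_along_al p : W p -> has_derive p (al p) net_rho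
  (net_rho p * (1 + 2 * net_rho p + net_rho p * net_tau p)).
Proof.
move=> Wp.
have f1 := has_derive_det (al_al Wp) (dB (al p) Wp).
have f2 := has_derive_det (al_al Wp) (be_al Wp).
have f3 := has_derive_det (be_al Wp) (dB2 (al p) Wp).
have n0 : det (al p) (be p) * det (be p) (B2 p) != 0 by rewrite mulf_neq0 ?d0 ?Q0.
have h := has_deriveN (has_derive_div (has_deriveM f1 f1) (has_deriveM f2 f3) n0).
apply: (@has_derive_eq _ _ _ _ _ net_rho _ _ h).
rewrite /net_tau /net_rho; move: (d0 Wp) (Q0 Wp) (aB0 Wp).
move: (al p) (be p) (B p) (B2 p) (B3 p) => x y w w2 w3 D0 Q1 xw0.
rewrite !detBl !detBr !detZl !detZr !detvv.
move: (det x w) (det x y) (det y w2) D0 Q1 xw0 => xw D Q D0 Q1 xw0.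
by field; rewrite D0 Q1 xw0.
Qed.

Lemma net_tau_along_be p : W p -> has_derive p (be p) net_tau (net_tau p - 3 / net_rho p).
Proof.
move=> Wp.
have f1 := has_derive_det (al_be Wp) (B2_be Wp).
have f2 := has_derive_det (al_be Wp) (be_be Wp).
have f3 := has_derive_det (al_be Wp) (B_be Wp).
have f4 := has_derive_det (be_be Wp) (B3_be Wp).
have f5 := has_derive_det (be_be Wp) (B2_be Wp).
have n0 : det (al p) (B p) * det (be p) (B2 p) != 0 by rewrite mulf_neq0 ?aB0 ?Q0.
have n1 : det (al p) (B p) * det (al p) (B p) != 0 by rewrite mulf_neq0 ?aB0.
have h := has_deriveB
  (has_derive_div (has_deriveM (has_derive_cst p (be p) (3 : R)) (has_deriveM f1 f2)) (has_deriveM f3 f3) n1)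
  (has_derive_div (has_deriveM f4 f2) (has_deriveM f3 f5) n0).
apply: (@has_derive_eq _ _ _ _ _ net_tau _ _ h).
rewrite /net_tau /net_rho; move: (net_lam p) (beB Wp) (d0 Wp) (Q0 Wp) (aB0 Wp).
move: (al p) (be p) (B p) (B2 p) (B3 p) => x y w w2 w3 l yw D0 Q1 xw0.
rewrite !detBl !detZl !det0r !detvv yw.
move: (det x w) (det x y) (det y w2) D0 Q1 xw0 => xw D Q D0 Q1 xw0.
by field; rewrite D0 Q1 xw0.
Qed.

Lemma net_not_flat V p : open V -> V `<=` W ->
  (forall q, V q -> net_lam q + net_rho q + 3 = 0) -> ~ V p.
Proof.
move=> oV VW flat.
apply: (overdetermined (al := al) (be := be) (tau := net_tau) oV flat).
- by move=> q /VW; exact: net_rho_neq0.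
- by move=> q /VW; exact: net_lam_along_al.
- by move=> q /VW; exact: net_rho_along_be.
- by move=> q /VW; exact: net_rho_along_al.
by move=> q /VW; exact: net_tau_along_be.
Qed.

End TwoCurves.

(** * Foliations by level sets *)

Section Chart.
Context {R : realType}.
Implicit Types (p q x : R * R) (U : set (R * R)).

Definition level_leaves U (P : R * R -> R) : set (set (R * R)) :=
  [set l | exists2 q, U q & l = [set p | U p /\ P p = P q]].

Variables (U D : set (R * R)) (phi psi : R * R -> R * R).
Hypotheses (oU : open U) (oD : open D) (sphi : smooth_on U phi)
  (spsi : smooth_on D psi)
  (phiD : forall p, U p -> D (phi p)) (psiU : forall x, D x -> U (psi x))
  (phiK : forall p, U p -> psi (phi p) = p) (psiK : forall x, D x -> phi (psi x) = x)
  (Dconv : forall c s t r, D (s, c) -> D (t, c) -> s <= r <= t -> D (r, c)).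

Let P p := (phi p).2.

Let imageD : phi @` U = D.
Proof.
apply/seteqP; split=> [x [p Up <-]|x Dx]; first exact: phiD.
by exists (psi x); [exact: psiU|exact: psiK].
Qed.

Let levelE q : U q -> [set p | U p /\ P p = P q] =
  (fun r => psi (r, P q)) @` [set r | D (r, P q)].
Proof.
move=> Uq; apply/seteqP; split=> [p [Up Pp]|p [r /= Dr <-]].
  have E : ((phi p).1, P q) = phi p by rewrite -Pp /P -surjective_pairing.
  by exists (phi p).1; rewrite /= E; [exact: phiD|exact: phiK].
by split; [exact: psiU|rewrite /P psiK].
Qed.

Let cont_slice c r : D (r, c) -> {for r, continuous (fun r => psi (r, c))}.
Proof.
move=> Dr; apply: (@continuous_comp _ _ _ (fun r : R => (r, c)) psi).
  have h : is_Ck 0 setT (fun r : R => (r, c)).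
    exact: Ck_pair openT (Ck_id _ _) (Ck_cst _ _ c).
  exact: h.
exact: smooth_continuous spsi Dr.
Qed.

Let level_connected q : U q -> connected [set p | U p /\ P p = P q].
Proof.
move=> Uq; rewrite levelE //; apply: connected_continuous_connected.
  apply/connected_intervalP => s t Ds Dt r srt; exact: Dconv srt.
by apply: continuous_in_subspaceT => r; rewrite inE /= => Dr; exact: cont_slice.
Qed.

Let level_path q : U q -> path_connected [set p | U p /\ P p = P q].
Proof.
move=> Uq p p' [Up Pp] [Up' Pp'].
pose s := (phi p).1; pose t := (phi p').1.
pose r u := s + u * (t - s).
have Es : (s, P q) = phi p by rewrite -Pp /P /s -surjective_pairing.
have Et : (t, P q) = phi p' by rewrite -Pp' /P /t -surjective_pairing.
have Ds : D (s, P q) by rewrite Es; exact: phiD.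
have Dt : D (t, P q) by rewrite Et; exact: phiD.
have Dr u : 0 <= u <= 1 -> D (r u, P q).
  move=> /andP[u0 u1]; have [st|/ltW ts] := leP s t.
    apply: (Dconv Ds Dt); rewrite /r lerDl mulr_ge0 ?subr_ge0 //=.
    by rewrite -lerBrDl ler_piMl // subr_ge0.
  apply: (Dconv Dt Ds); rewrite /r gerDl mulr_ge0_le0 ?subr_le0 // andbT.
  by rewrite -lerBlDl ler_niMl // subr_le0.
exists (fun u => psi (r u, P q)); split.
- apply: continuous_in_subspaceT => u; rewrite inE /= in_itv /= => u01.
  apply: (@continuous_comp _ _ _ r (fun r => psi (r, P q))); last exact: cont_slice (Dr u u01).
  apply: continuousD; first exact: cst_continuous.
  by apply: continuousM; [exact: cvg_id|exact: cst_continuous].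
- by rewrite /r mul0r addr0 Es phiK.
- by rewrite /r mul1r addrC subrK Et phiK.
by move=> u u01; split; [exact: psiU (Dr u u01)|rewrite /P psiK //; exact: Dr].
Qed.

(** A leaf is the image under [psi] of a horizontal slice of [D], which is an interval by
   [Dconv]. Leaves are therefore connected, and [phi] serves as a single chart around
   every point of [U]. *)
Lemma foliation_level_leaves : foliation U (level_leaves U (fun p => (phi p).2)).
Proof.
split.
- exact: oU.
- move=> l [q Uq ->]; split; [by exists q|by move=> p []|exact: level_path].
- by move=> p Up; exists [set p' | U p' /\ P p' = P p] => //; exists p.
- move=> l l' [q Uq ->] [q' Uq' ->] [p [[_ Pp] [_ Pp']]].
  by rewrite -Pp -Pp'.
move=> p Up; exists U, phi; split=> //.
  split; [exact: oU|exact: sphi|exists psi; rewrite imageD; split=> //].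
move=> l q [q' Uq' ->] [Uq [_ Pq]].
have -> : U `&` [set p | U p /\ (phi p).2 = (phi q').2] =
          [set p | U p /\ P p = P q].
  by apply/seteqP; split=> x; rewrite /= /P Pq; tauto.
by rewrite connected_component_id //; exact: level_connected.
Qed.

End Chart.

(** * Tangent spaces of foliations by tangent lines *)

Section Tangent.
Context {R : realType}.
Implicit Types (p q v : R * R) (U V : set (R * R)).
Variables (L : R -> R * R) (I : set R) (a d : R) (WL : set (R * R)) (S : R * R -> R).
Hypothesis tS : tangent_param L I a d WL S.

Let S_uniq p s : WL p -> `|s - a| < d -> incid L p s = 0 -> s = S p.
Proof. by case: tS => _ _ _ h _; exact: h. Qed.
Let S_near p : WL p -> `|S p - a| < d.
Proof. by move=> Wp; case: tS => _ _ h _ _; have [] := h _ Wp. Qed.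
Let S_incid p : WL p -> incid L p (S p) = 0.
Proof. by move=> Wp; case: tS => _ _ h _ _; have [] := h _ Wp. Qed.

(** Differentiate the identity [incid L (g t) s = 0] at [t = 0]. *)
Lemma velocity_tangent_line (g : R -> R * R) (N : set R) s : nbhs (0 : R) N ->
  differentiable g 0 -> (forall t, N t -> incid L (g t) s = 0) ->
  det (g^`() 0) ('D_1 L s) = 0.
Proof.
move=> N0 dg gN; rewrite derive1E.
have gi : N° 0 by exact: N0.
have hg : has_derive (0 : R) 1 g ('D_1 g 0) by split.
have := has_derive_det (has_deriveB hg (has_derive_cst (0 : R) (1 : R) (L s)))
  (has_derive_cst (0 : R) (1 : R) ('D_1 L s)).
rewrite subr0 det0r addr0; apply: has_derive_zero gi _; first exact: open_interior.
by move=> t /interior_subset /gN.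
Qed.

(** A level set of [S] lies on a single tangent line, so its velocities are
   along that line. Conversely a short segment of that line through [p] stays in the level set, by
   uniqueness of the contact parameter. *)
Lemma tangent_level_leaves U p v : open U -> U `<=` WL -> U p ->
  tangent (level_leaves U S) p v <-> det v ('D_1 L (S p)) = 0.
Proof.
move=> oU UW Up; have Wp := UW _ Up; split.
  move=> [l [N [g [[q Uq ->] oN N0 sg [gl g0 <-]]]]].
  apply: (@velocity_tangent_line g N); first exact: open_nbhs_nbhs.
    exact: smooth_differentiable sg N0.
  move=> t Nt; have [Ut St] := gl t Nt; have [_ Sp] := gl 0 N0.
  by rewrite g0 in Sp; rewrite Sp -St; exact: S_incid (UW _ Ut).
move=> v0.
pose g t := p + t *: v.
have sg : smooth_on setT g.
  move=> k; have oT := @openT R.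
  exact: CkD oT (Ck_cst _ _ p) (Ck_scale oT (Ck_id _ _) (Ck_cst _ _ v)).
pose N := g @^-1` U.
have oN : open N by apply: open_comp => // t _; exact: smooth_continuous sg _.
have g0 : g 0 = p by rewrite /g scale0r addr0.
have Sg t : N t -> S (g t) = S p.
  move=> Nt; apply/esym; apply: S_uniq; [exact: UW|exact: S_near|].
  have := S_incid Wp; rewrite /incid /g; move: ('D_1 L (S p)) v0 => w v0 E.
  have -> : p + t *: v - L (S p) = (p - L (S p)) + t *: v by rewrite addrAC.
  by rewrite detDl E detZl v0 mulr0 addr0.
exists [set q | U q /\ S q = S p], N, g; split.
- by exists p.
- exact: oN.
- by rewrite /N /= g0.
- by move=> k; exact: Ck_sub (@subsetT _ _) (sg k).
split; [by move=> t Nt; split; [exact: Nt|exact: Sg]|exact: g0|].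
rewrite derive1E.
have h1 : differentiable (fun t : R => t) 0 by [].
have h2 : differentiable (fun=> v : R * R) (0 : R) by exact: differentiable_cst.
have h3 : differentiable (fun t : R => t *: v) 0 by exact: differentiable_scale h1 h2.
have [_] := has_deriveD (has_derive_cst (0 : R) (1 : R) p) (conj h3 erefl).
rewrite (derive_scale (1 : R) h1 h2) derive_cst scaler0 addr0 derive_id scale1r add0r.
exact.
Qed.

(** For small times the curve stays in [V], hence, being connected, in the component of
   the leaf through [p], which lies on one tangent line of [L]. That line passes
   through [p], so it is the one at [S p]. *)
Lemma tangent_germ_direction V (F : set (set (R * R))) p v : open V ->
  (forall p l, V p -> F l -> l p -> exists2 s, `|s - a| < d &
     connected_component (V `&` l) p `<=` tangent_line L s) ->
  V p -> WL p -> tangent F p v -> det v ('D_1 L (S p)) = 0.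
Proof.
move=> oV Vgerm Vp Wp [l [N [g [Fl oN N0 sg [gl g0 <-]]]]].
have lp : l p by rewrite -g0; exact: gl.
have [s sa comp] := Vgerm p l Vp Fl lp.
have line q : tangent_line L s q -> incid L q s = 0.
  move=> [c _ /= E]; rewrite /incid -derive1E -E detZl.
  by rewrite detvv mulr0.
have Es : s = S p.
  apply: S_uniq => //; apply: line; apply: comp.
  exact: connected_component_refl.
have nV : \forall t \near (0 : R), N t /\ V (g t).
  apply: filterI; first exact: open_nbhs_nbhs.
  by apply: (smooth_continuous sg N0); rewrite g0; exact: open_nbhs_nbhs.
have /nbhs_ballP[r /= r0 rV] := nV.
rewrite -Es; apply: (@velocity_tangent_line g (ball (0 : R) r)).
- exact: nbhsx_ballx.
- exact: smooth_differentiable sg N0.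
move=> t tr; apply: line; apply: comp.
apply: (@connected_component_max _ _ (g @` ball (0 : R) r)).
- by exists 0 => //; exact: ballxx.
- by move=> _ [u ur <-]; have [Nu Vu] := rV _ ur; split=> //; exact: gl.
- apply: connected_continuous_connected.
    apply/connected_intervalP => x y; rewrite /ball /= => xr yr z xyz.
    by rewrite distrC; apply: dist_lt_between xyz; rewrite distrC.
  apply: continuous_in_subspaceT => u; rewrite inE => ur.
  by have [Nu _] := rV _ ur; exact: smooth_continuous sg Nu.
by exists t.
Qed.

End Tangent.

(** * The structure-germ of two curves *)

Section Existence.
Context {R : realType}.
Variables (L K : R -> R * R) (I J : set R) (a b d e : R) (WL WK : set (R * R))
  (S T : R * R -> R) (p0 : R * R).
Hypotheses (oI : open I) (oJ : open J) (sL : smooth_on I L) (sK : smooth_on J K)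
  (d0 : 0 < d) (e0 : 0 < e)
  (tS : tangent_param L I a d WL S) (tT : tangent_param K J b e WK T).
Implicit Types (p q v w z x : R * R).
Let al := radial L S.
Let be := radial K T.
Let W := net_domain L K WL WK S T.
Hypotheses (Wp0 : W p0) (Sp0 : S p0 = a) (Tp0 : T p0 = b).

Let WWL p : W p -> WL p. Proof. by move=> [[[]]]. Qed.
Let WWK p : W p -> WK p. Proof. by move=> [[[]]]. Qed.
Let AB0 p : W p -> det ('D_1 L (S p)) ('D_1 K (T p)) != 0. Proof. by case. Qed.
Let S_spec p : W p -> [/\ `|S p - a| < d, I (S p) & incid L p (S p) = 0].
Proof. by move=> /WWL Wp; case: tS => _ _ h _ _; have [] := h _ Wp. Qed.
Let T_spec p : W p -> [/\ `|T p - b| < e, J (T p) & incid K p (T p) = 0].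
Proof. by move=> /WWK Wp; case: tT => _ _ h _ _; have [] := h _ Wp. Qed.
Let frame : radial_frame W al be (net_lam L K S T) (net_rho L K S T).
Proof. exact: radial_frame_net oI oJ sL sK tS tT. Qed.
Let oW : open W. Proof. by case: frame. Qed.
Let sSW : smooth_on W S.
Proof. by move=> k; apply: (@Ck_sub _ _ _ _ WL); [exact: WWL|case: tS => _ h _ _ _; exact: h]. Qed.
Let sTW : smooth_on W T.
Proof. by move=> k; apply: (@Ck_sub _ _ _ _ WK); [exact: WWK|case: tT => _ h _ _ _; exact: h]. Qed.

(** The intersection point of the tangent lines at [L x.1] and [K x.2], by Cramer's rule;
   the inverse of the chart [(S, T)]. *)
Definition tangent_meet x : R * R := L x.1 +
  (det (K x.2 - L x.1) ('D_1 K x.2) / det ('D_1 L x.1) ('D_1 K x.2)) *: 'D_1 L x.1.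

Lemma meetP s t p : det ('D_1 L s) ('D_1 K t) != 0 ->
  incid L p s = 0 -> incid K p t = 0 -> tangent_meet (s, t) = p.
Proof.
rewrite /incid /tangent_meet /=; move: ('D_1 L s) ('D_1 K t) => u w uw pu pw.
have up : det u (p - L s) = 0 by rewrite detC pu oppr0.
have E := proportional uw up.
suff -> : det (K t - L s) w = det (p - L s) w by rewrite -E addrC subrK.
apply/eqP; rewrite eq_sym -subr_eq0 -detBl; apply/eqP; rewrite -pw.
by rewrite /det /=; ring.
Qed.

Lemma incid_meet s t : det ('D_1 L s) ('D_1 K t) != 0 ->
  incid L (tangent_meet (s, t)) s = 0 /\ incid K (tangent_meet (s, t)) t = 0.
Proof.
rewrite /incid /tangent_meet /=; move: ('D_1 L s) ('D_1 K t) (L s) (K t) => u w l k uw.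
have h c : l + c *: u - k = c *: u - (k - l).
  by apply: pair_eq; rewrite /= /GRing.scale /=; ring.
split; first by rewrite addrAC subrr add0r detZl detvv mulr0.
by rewrite h [LHS]detBl detZl divfK // subrr.
Qed.

Let meet_domain : set (R * R) := [set x | I x.1 /\ J x.2] `&`
  [set x | det ('D_1 L x.1) ('D_1 K x.2) != 0].
Let oIJ : open [set x | I x.1 /\ J x.2].
Proof.
apply: openI; apply: open_comp => // x _; [exact: cvg_fst|exact: cvg_snd].
Qed.
Let Ck_L k (V : set (R * R)) : open V -> (forall x, V x -> I x.1) -> is_Ck k V (fun x => L x.1).
Proof. by move=> oV VI; exact: Ck_curve oI oV VI (sL k) (Ck_fst oV (Ck_id _ _)). Qed.
Let Ck_K k (V : set (R * R)) : open V -> (forall x, V x -> J x.2) -> is_Ck k V (fun x => K x.2).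
Proof. by move=> oV VI; exact: Ck_curve oJ oV VI (sK k) (Ck_snd oV (Ck_id _ _)). Qed.
Let Ck_L1 k (V : set (R * R)) : open V -> (forall x, V x -> I x.1) -> is_Ck k V (fun x => 'D_1 L x.1).
Proof. by move=> oV VI; exact: Ck_curve oI oV VI (smooth_velocity sL k) (Ck_fst oV (Ck_id _ _)). Qed.
Let Ck_K1 k (V : set (R * R)) : open V -> (forall x, V x -> J x.2) -> is_Ck k V (fun x => 'D_1 K x.2).
Proof. by move=> oV VI; exact: Ck_curve oJ oV VI (smooth_velocity sK k) (Ck_snd oV (Ck_id _ _)). Qed.

Let oD0 : open meet_domain.
Proof.
apply: open_neq0_in => // x Vx.
have h := Ck_det oIJ (Ck_L1 0 oIJ (fun x h => h.1)) (Ck_K1 0 oIJ (fun x h => h.2)).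
exact: h.
Qed.

Let smooth_meet : smooth_on meet_domain tangent_meet.
Proof.
move=> k.
have h1 := Ck_L k oD0 (fun x h => h.1.1); have h2 := Ck_K k oD0 (fun x h => h.1.2).
have h3 := Ck_L1 k oD0 (fun x h => h.1.1); have h4 := Ck_K1 k oD0 (fun x h => h.1.2).
have n0 x : meet_domain x -> det ('D_1 L x.1) ('D_1 K x.2) != 0 by case.
have f := CkM oD0 (Ck_det oD0 (CkB_pair oD0 h2 h1) h4) (CkV oD0 n0 (Ck_det oD0 h3 h4)).
exact: CkD oD0 h1 (Ck_scale oD0 f h3).
Qed.

Definition net_box (r : R) : set (R * R) := [set x | `|x.1 - a| < r /\ `|x.2 - b| < r].

(** The tangent lines at [L a] and [K b] meet in [p0], so the four conditions hold at
   [(a, b)], and they are open. *)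
Lemma exists_net_box : exists r, [/\ 0 < r, r <= d, r <= e, net_box r `<=` meet_domain &
  forall x, net_box r x -> W (tangent_meet x)].
Proof.
have [_ IS LS] := S_spec Wp0; have [_ JT KT] := T_spec Wp0.
have Dab : meet_domain (a, b) by rewrite /meet_domain /= -Sp0 -Tp0; split; [split|exact: AB0].
have mab : tangent_meet (a, b) = p0.
  by apply: meetP; [rewrite -Sp0 -Tp0; exact: AB0|rewrite -Sp0|rewrite -Tp0].
have n1 : nbhs ((a, b) : R * R) (meet_domain `&` tangent_meet @^-1` W).
  have h := smooth_continuous smooth_meet Dab.
  rewrite /prop_for /continuous_at mab in h.
  have nD := open_nbhs_nbhs (conj oD0 Dab).
  have nW := open_nbhs_nbhs (conj oW Wp0).
  apply: filterI; first exact: nD.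
  by have := h W nW; rewrite /nbhs /=.
have [[A B] [/= /nbhs_ballP[r1 /= r10 A1] /nbhs_ballP[r2 /= r20 B1]] AB] := n1.
pose r := Num.min (Num.min r1 r2) (Num.min d e).
have r0 : 0 < r by rewrite !lt_min r10 r20 d0 e0.
have [h1 h2 h3 h4] : [/\ r <= r1, r <= r2, r <= d & r <= e].
  by rewrite /r; split; rewrite !ge_min lexx ?orbT.
have boxAB x : net_box r x -> meet_domain x /\ W (tangent_meet x).
  move=> [xa xb]; apply: (AB x); split.
    by apply: A1; rewrite /ball /= distrC; exact: lt_le_trans h1.
  by apply: B1; rewrite /ball /= distrC; exact: lt_le_trans h2.
exists r; split; [exact: r0|exact: h3|exact: h4| |].
  by move=> x /boxAB [].
by move=> x /boxAB [].
Qed.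

Variable r : R.
Hypotheses (r0 : 0 < r) (rd : r <= d) (re : r <= e) (boxD : net_box r `<=` meet_domain)
  (boxW : forall x, net_box r x -> W (tangent_meet x)).

Definition net_open : set (R * R) :=
  W `&` [set p | net_box r (S p, T p)].
Let U := net_open.
Let UW : U `<=` W. Proof. by move=> p []. Qed.

Let open_box : open (net_box r).
Proof.
have -> : net_box r = fst @^-1` ball a r `&` snd @^-1` ball b r.
  by apply/seteqP; split=> x; rewrite /net_box /ball /= ![`|_ - x.1|]distrC ![`|_ - x.2|]distrC.
apply: openI; apply: open_comp; try exact: ball_open.
  by move=> x _; exact: cvg_fst.
by move=> x _; exact: cvg_snd.
Qed.

Let oU : open U.
Proof.
rewrite openE => p [Wp bp]; apply: filterI; first exact: open_nbhs_nbhs.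
have h := Ck_pair oW (sSW 0%N) (sTW 0%N).
by apply: (h p Wp); exact: open_nbhs_nbhs.
Qed.

Let meetK x : net_box r x -> S (tangent_meet x) = x.1 /\ T (tangent_meet x) = x.2.
Proof.
case: x => s t bx; have Wm := boxW bx; have [_ /= n0] := boxD bx.
have [iL iK] := incid_meet n0; have [/= xs xt] := bx.
split; apply/esym.
  by case: tS => _ _ _ h _; apply: h (WWL Wm) (lt_le_trans xs rd) iL.
by case: tT => _ _ _ h _; apply: h (WWK Wm) (lt_le_trans xt re) iK.
Qed.

Let ST_meet p : U p -> tangent_meet (S p, T p) = p.
Proof.
move=> [Wp _]; have [_ _ hS] := S_spec Wp; have [_ _ hT] := T_spec Wp.
by apply: meetP => //; exact: AB0.
Qed.

Let Umeet x : net_box r x -> U (tangent_meet x).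
Proof.
move=> bx; split; first exact: boxW.
by have [/= -> ->] := meetK bx; case: x bx.
Qed.

Let sSU : smooth_on U S. Proof. by move=> k; exact: Ck_sub UW (sSW k). Qed.
Let sTU : smooth_on U T. Proof. by move=> k; exact: Ck_sub UW (sTW k). Qed.
Let meet_box k : is_Ck k (net_box r) tangent_meet. Proof. exact: Ck_sub boxD (smooth_meet k). Qed.

(** Leaves must be level sets of the second coordinate of a chart, so the chart is
   [(T, S)] for the first foliation and [(S, T)] for the second. *)
Lemma foliation_net : foliation U (level_leaves U S) /\ foliation U (level_leaves U T).
Proof.
split.
  pose D := [set x : R * R | net_box r (x.2, x.1)].
  have oswap : forall x, {for x, continuous (fun x : R * R => (x.2, x.1))}.
    move=> x; have oT := @openT (R * R)%type.
    have h := Ck_pair oT (Ck_snd oT (Ck_id 0 setT)) (Ck_fst oT (Ck_id 0 setT)).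
    exact: h.
  have oD : open D.
    by apply: (@open_comp _ _ (fun x : R * R => (x.2, x.1)) (net_box r)) => [x _|];
      [exact: oswap|exact: open_box].
  have D1 x : D x -> `|x.2 - a| < r by case.
  have D2 x : D x -> `|x.1 - b| < r by case.
  apply: (@foliation_level_leaves _ U D (fun p => (T p, S p)) (fun x => tangent_meet (x.2, x.1))).
  - exact: oU.
  - exact: oD.
  - by move=> k; exact: Ck_pair oU (sTU k) (sSU k).
  - move=> k; have i := Ck_id k D.
    have h1 x : D x -> I x.2 by move=> /boxD [[]].
    have h2 x : D x -> J x.1 by move=> /boxD [[]].
    have n0 x : D x -> det ('D_1 L x.2) ('D_1 K x.1) != 0 by move=> /boxD [].
    have f1 := Ck_curve oI oD h1 (sL k) (Ck_snd oD i).
    have f2 := Ck_curve oJ oD h2 (sK k) (Ck_fst oD i).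
    have f3 := Ck_curve oI oD h1 (smooth_velocity sL k) (Ck_snd oD i).
    have f4 := Ck_curve oJ oD h2 (smooth_velocity sK k) (Ck_fst oD i).
    have f := CkM oD (Ck_det oD (CkB_pair oD f2 f1) f4) (CkV oD n0 (Ck_det oD f3 f4)).
    exact: CkD oD f1 (Ck_scale oD f f3).
  - by move=> p [].
  - by move=> x /Umeet.
  - by move=> p; exact: ST_meet.
  - by move=> x /meetK /= [-> ->]; case: x.
  - by move=> c s t u [Ds1 Ds2] [Dt1 Dt2] stu; split; [exact: Ds1|exact: dist_lt_between Ds2 Dt2 stu].
apply: (@foliation_level_leaves _ U (net_box r) (fun p => (S p, T p)) tangent_meet).
- exact: oU.
- exact: open_box.
- by move=> k; exact: Ck_pair oU (sSU k) (sTU k).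
- by move=> k; exact: meet_box.
- by move=> p [].
- by move=> x; exact: Umeet.
- by move=> p; exact: ST_meet.
- by move=> x /meetK [-> ->]; case: x.
by move=> c s t u [Ds1 Ds2] [Dt1 Dt2] stu; split; [exact: dist_lt_between Ds1 Dt1 stu|exact: Ds2].
Qed.

Let F := level_leaves U S.
Let G := level_leaves U T.

Lemma tangent_net p v : U p ->
  (tangent F p v <-> det v (al p) = 0) /\ (tangent G p v <-> det v (be p) = 0).
Proof.
move=> Up; have Wp := UW Up; split.
  apply: iff_trans _ (tangent_al tS v Wp).
  by apply: (tangent_level_leaves tS) => // q /UW; exact: WWL.
apply: iff_trans _ (tangent_be tT v Wp).
by apply: (tangent_level_leaves tT) => // q /UW; exact: WWK.
Qed.

Lemma symplectic_omega0 (V : set (R * R)) : symplectic V omega0.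
Proof.
split.
- by move=> v w k; exact: Ck_cst.
- by move=> p v v' w c _; exact: (etrans (detDl (c *: v) v' w) (congr1 (+%R^~ _) (detZl c v w))).
- by move=> p v w _; exact: detC.
move=> p v _ h; apply: pair_eq.
  by have := h (0, 1); rewrite /omega0 /= mulr1 mulr0 subr0.
by have := h (- 1, 0); rewrite /omega0 /= mulr0 sub0r mulrN1 opprK.
Qed.

Lemma bilagrangian_net : bilagrangian U omega0 F G.
Proof.
have ab0 p : U p -> det (al p) (be p) != 0 by move=> /UW [[]].
split; [exact: symplectic_omega0|exact: foliation_net| |].
  split=> p v w Up.
    move=> /(tangent_net v Up).1 v0 /(tangent_net w Up).1 w0; rewrite -[LHS]/(det v w).
    rewrite (parallel_al frame (UW Up) v0) (parallel_al frame (UW Up) w0).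
    by rewrite detZl detZr detvv !mulr0.
  move=> /(tangent_net v Up).2 v0 /(tangent_net w Up).2 w0; rewrite -[LHS]/(det v w).
  rewrite (parallel_be frame (UW Up) v0) (parallel_be frame (UW Up) w0).
  by rewrite detZl detZr detvv !mulr0.
move=> p Up z; exists (coord1 al be p z *: al p), (coord2 al be p z *: be p); split.
- by apply/(tangent_net _ Up).1; rewrite detZl detvv mulr0.
- by apply/(tangent_net _ Up).2; rewrite detZl detvv mulr0.
exact: (coord_decomp frame z (UW Up)).
Qed.

Lemma incid_tangent_line (g : R -> R * R) p s u : det ('D_1 g s) u != 0 ->
  incid g p s = 0 -> tangent_line g s p.
Proof.
move=> gu /eqP; rewrite /incid detC oppr_eq0 => /eqP h.
exists (det (p - g s) u / det ('D_1 g s) u) => //.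
by rewrite derive1E -(proportional gu h).
Qed.

Lemma tangent_foliation_germ_net :
  tangent_foliation_germ L a p0 U F /\ tangent_foliation_germ K b p0 U G.
Proof.
have Up0 : U p0 by split=> //; rewrite /net_box /= Sp0 Tp0 !subrr normr0.
have near_open (P : R * R -> R) c eps : smooth_on U P ->
    open (U `&` [set p | `|P p - c| < eps]).
  move=> sP.
  have -> : U `&` [set p | `|P p - c| < eps] =
      (U `&` [set p | 0 < P p - (c - eps)]) `&` [set p | 0 < c + eps - P p].
    apply/seteqP; split=> x /=; rewrite ltr_distl !subr_gt0.
      by move=> [Ux /andP[]].
    by move=> [[Ux h1] h2]; split=> //; rewrite h1 h2.
  have f1 := CkB oU (sP 0%N) (Ck_cst 0 U (c - eps)).
  have f2 := CkB oU (Ck_cst 0 U (c + eps)) (sP 0%N).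
  apply: open_gt0_in; first by apply: open_gt0_in => // x Ux; exact: f1.
  by move=> x [Ux _]; exact: f2.
split=> eps eps0.
  exists (U `&` [set p | `|S p - a| < eps]); split.
  - exact: near_open _ _ _ sSU.
  - by split=> //=; rewrite Sp0 subrr normr0.
  - by move=> p [].
  move=> p l [Up Sp] [q Uq ->] [_ Spq]; exists (S p) => // x /connected_component_sub.
  move=> [_ [Ux Sx]]; rewrite Spq -Sx.
  have [_ _ h] := S_spec (UW Ux); exact: incid_tangent_line (AB0 (UW Ux)) h.
exists (U `&` [set p | `|T p - b| < eps]); split.
- exact: near_open _ _ _ sTU.
- by split=> //=; rewrite Tp0 subrr normr0.
- by move=> p [].
move=> p l [Up Tp] [q Uq ->] [_ Tpq]; exists (T p) => // x /connected_component_sub.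
move=> [_ [Ux Tx]]; rewrite Tpq -Tx.
apply: (incid_tangent_line (u := 'D_1 L (S x))); last by have [] := T_spec (UW Ux).
by rewrite detC oppr_eq0; exact: AB0 (UW Ux).
Qed.

Lemma net_structure :
  bilagrangian_tangent_germ L a K b p0 U F G /\
  canonical_connection U omega0 F G (radial_connection al be).
Proof.
have [gF gG] := tangent_foliation_germ_net.
split.
  split; [|exact: bilagrangian_net|exact: gF|exact: gG].
  by split=> //; rewrite /net_box /= Sp0 Tp0 !subrr normr0.
apply: (canonical_radial_connection frame UW) => p v Up.
  exact: (tangent_net v Up).1.
exact: (tangent_net v Up).2.
Qed.

End Existence.

(** * Non-flatness *)

Section NeverFlat.
Context {R : realType}.
Variables (L K : R -> R * R) (I J : set R) (a b d e : R) (WL WK : set (R * R))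
  (S T : R * R -> R) (p0 : R * R).
Hypotheses (oI : open I) (oJ : open J) (sL : smooth_on I L) (sK : smooth_on J K)
  (d0 : 0 < d) (e0 : 0 < e)
  (tS : tangent_param L I a d WL S) (tT : tangent_param K J b e WK T).
Implicit Types (p q v w z : R * R).
Let al := radial L S.
Let be := radial K T.
Let W := net_domain L K WL WK S T.
Hypothesis Wp0 : W p0.

(** Near [p0] the tangent spaces of [F] and [G] are contained in the lines spanned by [al]
   and [be]; as they span the plane, they are equal to them. *)
Lemma never_flat U (F G : set (set (R * R))) nabla :
  bilagrangian_tangent_germ L a K b p0 U F G ->
  canonical_connection U omega0 F G nabla -> ~ flat_at p0 U nabla.
Proof.
move=> [Up0 [_ _ _ tr] gF gG] canon [V0 [oV0 V0p0 V0U flat]].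
have [V1 [oV1 V1p0 V1U germF]] := gF d d0.
have [V2 [oV2 V2p0 V2U germG]] := gG e e0.
have frame := radial_frame_net oI oJ sL sK tS tT.
have oW : open W by case: frame.
pose V := ((V0 `&` V1) `&` V2) `&` W.
have oV : open V by apply: openI => //; apply: openI => //; exact: openI.
have Vp0 : V p0 by [].
have VW : V `<=` W by move=> p [].
have VU : V `<=` U by move=> p [[[/V0U]]].
have dF p v : V p -> tangent F p v -> det v ('D_1 L (S p)) = 0.
  move=> [[[_ V1p] _] Wp]; apply: (tangent_germ_direction tS oV1 germF V1p).
  by case: Wp => [[[]]].
have dG p v : V p -> tangent G p v -> det v ('D_1 K (T p)) = 0.
  move=> [[_ V2p] Wp]; apply: (tangent_germ_direction tT oV2 germG V2p).
  by case: Wp => [[[]]].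
have AB0 p : V p -> det ('D_1 L (S p)) ('D_1 K (T p)) != 0 by move=> /VW [].
have split0 p v : V p -> det v ('D_1 L (S p)) = 0 -> det v ('D_1 K (T p)) = 0 -> v = 0.
  move=> /AB0; move: ('D_1 L (S p)) ('D_1 K (T p)) => u w uw vu vw.
  have uv : det u v = 0 by rewrite detC vu oppr0.
  by have := proportional uw uv; rewrite vw mul0r scale0r.
have tF p v : V p -> tangent F p v <-> det v (al p) = 0.
  move=> Vp; have Wp := VW _ Vp.
  apply: iff_trans _ (tangent_al tS v Wp); split; first exact: dF.
  move=> v0; have [f [g [Ff Gg E]]] := tr p (VU _ Vp) v.
  have g0 : g = 0.
    apply: (split0 p g Vp _ (dG _ _ Vp Gg)).
    by move: v0; rewrite E detDl (dF _ _ Vp Ff) add0r.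
  by rewrite E g0 addr0.
have tG p v : V p -> tangent G p v <-> det v (be p) = 0.
  move=> Vp; have Wp := VW _ Vp.
  apply: iff_trans _ (tangent_be tT v Wp); split; first exact: dG.
  move=> v0; have [f [g [Ff Gg E]]] := tr p (VU _ Vp) v.
  have f0 : f = 0.
    apply: (split0 p f Vp (dF _ _ Vp Ff)).
    by move: v0; rewrite E detDl (dG _ _ Vp Gg) addr0.
  by rewrite E f0 add0r.
apply: (net_not_flat oI oJ sL sK tS tT oV VW _ Vp0) => q Vq.
apply: (flat_relation frame canon oV VU VW tF tG Vq) => v w z.
have [[[V0q _] _] _] := Vq.
by apply: flat V0q => k; exact: Ck_cst.
Qed.

End NeverFlat.

Section Germ.
Context {R : realType}.

Lemma curvature_det (L : R -> R * R) a : curvature L a <> 0 ->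
  det ('D_1 L a) ('D_1 ('D_1 L) a) != 0.
Proof.
have E1 : L^`() = 'D_1 L by apply/funext => s; rewrite derive1E.
have E2 : L^`(2) = 'D_1 ('D_1 L).
  by apply/funext => s; rewrite derive1nS derive1n1 E1 derive1E.
rewrite /curvature E2 E1 => h; apply/eqP => h0; apply: h.
by rewrite -[_ - _]/(det ('D_1 L a) ('D_1 ('D_1 L) a)) h0 mul0r.
Qed.

(** If [p0 - L a = c *: L' a], then [dincid L p0 a] is [c] times [det L' L''] at [a], which
   is nonzero for a curved germ and [p0 <> p1]. *)
Lemma curve_tangent_param (L : R -> R * R) a p0 p1 : curve_germ L a p1 ->
  tangent_line L a p0 -> p0 <> p1 -> curvature L a <> 0 ->
  exists I d WL S, [/\ open I, smooth_on I L, 0 < d, WL p0 &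
    tangent_param L I a d WL S /\ S p0 = a].
Proof.
move=> [[I [oI Ia sL]] _ La] [c _ Ep0] p01 /curvature_det kL.
rewrite derive1E /= in Ep0.
have c0 : c != 0.
  by apply/eqP => E; apply: p01; move/eqP: Ep0; rewrite E scale0r eq_sym subr_eq0 La => /eqP.
have i0 : incid L p0 a = 0 by rewrite /incid -Ep0 detZl detvv mulr0.
have di0 : dincid L p0 a != 0 by rewrite /dincid -Ep0 detZl mulf_neq0.
have [d [WL [S [d0 Wp0 _ tS]]]] := exists_tangent_param oI sL Ia i0 di0.
exists I, d, WL, S; split=> //; split=> //; apply/esym.
by case: tS => _ _ _ h _; apply: h => //; rewrite subrr normr0.
Qed.

End Germ.

Unset Implicit Arguments.

Theorem theorem23 (R : realType) (L K : R -> R * R) (a b : R)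
    (p0 p1 p2 : R * R)
    (hL : curve_germ L a p1) (hK : curve_germ K b p2) (hp : p1 <> p2)
    (ha : [/\ tangent_line L a p0, tangent_line K b p0 &
              transverse (tangent_space L a) (tangent_space K b)])
    (hb : transverse (line_span (p2 - p1)) (tangent_space L a) /\
          transverse (line_span (p2 - p1)) (tangent_space K b))
    (hc : curvature L a <> 0 /\ curvature K b <> 0) :
  (exists U F G nabla,
     bilagrangian_tangent_germ L a K b p0 U F G /\
     canonical_connection U omega0 F G nabla) /\
  (forall U F G nabla,
     bilagrangian_tangent_germ L a K b p0 U F G ->
     canonical_connection U omega0 F G nabla -> ~ flat_at p0 U nabla).
Proof.
have [tL tK /transverse_det AB] := ha.
have [/transverse_det cL /transverse_det cK] := hb.
have [kL kK] := hc.
have La : L a = p1 by case: hL.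
have Kb : K b = p2 by case: hK.
(* Otherwise the line through [p1] and [p2] would be tangent to [K], respectively to
   [L]. *)
have p01 : p0 <> p1.
  move=> E; move/eqP: cK; apply; have [c _ /= h] := tK.
  rewrite E Kb in h.
  by rewrite -opprB -h -scaleN1r !detZl detvv !mulr0.
have p02 : p0 <> p2.
  move=> E; move/eqP: cL; apply; have [c _ /= h] := tL.
  rewrite E La in h.
  by rewrite -h detZl detvv mulr0.
have [I [d [WL [S [oI sL d0 WLp0 [tS Sp0]]]]]] := curve_tangent_param hL tL p01 kL.
have [J [e [WK [T [oJ sK e0 WKp0 [tT Tp0]]]]]] := curve_tangent_param hK tK p02 kK.
have Wp0 : net_domain L K WL WK S T p0.
  rewrite !derive1E in AB.
  split; [split; [by []|]|by rewrite /= Sp0 Tp0].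
  have [c _ /= hc1] := tL; have [c' _ /= hc2] := tK.
  rewrite /= /radial Sp0 Tp0 -hc1 -hc2 !derive1E detZl detZr.
  have c0 : c != 0.
    by apply/eqP => E; apply: p01; move/eqP: hc1; rewrite E scale0r eq_sym subr_eq0 La => /eqP.
  have c0' : c' != 0.
    by apply/eqP => E; apply: p02; move/eqP: hc2; rewrite E scale0r eq_sym subr_eq0 Kb => /eqP.
  by rewrite !mulf_neq0.
split; last first.
  by move=> U F G nabla; exact: never_flat oI oJ sL sK d0 e0 tS tT Wp0 U F G nabla.
have [r [r0 rd re boxD boxW]] := exists_net_box oI oJ sL sK d0 e0 tS tT Wp0 Sp0 Tp0.
do 4 eexists; exact: net_structure oI oJ sL sK tS tT Wp0 Sp0 Tp0 r r0 rd re boxD boxW.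
Qed.
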